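(* Let $\nu$ be such that $n:=\nu-\frac12\in\mathbb{N}=\{0,1,2,\ldots\}$, let $r,\sigma>0$, and $c:=r\sigma$. Let $f\in\mathcal{L}^2(\mathbb{R}_+)$ be supported in $[0,\sigma]$. Then the Hankel transform $h:=\mathcal{H}_\nu[f]$ restricted to $[0,r]$ uniquely determines $f$ by the formula $$ f(s)=\frac{\sqrt{2\pi}\; i^{n}}{\sigma}\, s\,\frac{d^2}{ds^2}\int_s^{\sigma}\frac{s\,P_n(t/s)}{t^2}\;\mathcal{F}_c^{-1}[h_{r,\nu}](t/\sigma)\,dt,\qquad s\in(0,\sigma], $$ where $P_n$ is the Legendre polynomial of order $n$ and $$ h_{r,\nu}(x):=\begin{cases}\dfrac{1}{rx}\,h(rx), & x\in[0,1],\\[2mm] (-1)^{n}\,\dfrac{1}{rx}\,h(-rx)\cdot\varepsilon, & x\in[-1,0),\end{cases} \qquad \varepsilon:=-1. $$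
   Context: $\mathbb{R}_+=\{\rho\in\mathbb{R}: \rho\ge 0\}$ and $\mathbb{N}=\{0,1,2,\ldots\}$. The Hankel transform of order $\nu$ is $$\mathcal{H}_\nu[f](t)=\int_0^\infty f(s)\,J_\nu(ts)\,\sqrt{ts}\,ds,\qquad t\in\mathbb{R}_+,$$ where $J_\nu$ is the Bessel function of the first kind. For $c>0$, $\mathcal{F}_c$ is the integral operator on $\mathcal{L}^2([-1,1])$ given by $$\mathcal{F}_c[f](x)=\int_{-1}^1 e^{icxy}f(y)\,dy.$$ Its eigenfunctions $(\psi_{j,c})_{j\in\mathbb{N}}$ are the prolate spheroidal wave functions, taken real-valued and forming an orthonormal basis of $\mathcal{L}^2([-1,1])$, with corresponding eigenvalues $\mu_{j,c}$ satisfying $0<|\mu_{j+1,c}|<|\mu_{j,c}|$ for all $j\in\mathbb{N}$. The operator $\mathcal{F}_c$ is injective, and its inverse (on the range of $\mathcal{F}_c$) is $$\mathcal{F}_c^{-1}[g](y)=\sum_{j\in\mathbb{N}}\frac{1}{\mu_{j,c}}\,\psi_{j,c}(y)\int_{-1}^1\psi_{j,c}(x)\,g(x)\,dx .$$ The function $h_{r,\nu}$ has no singularity at $x=0$; its value at $0$ is understood as a limit. With $\varepsilon=-1$, the second case of the definition of $h_{r,\nu}$ reads $h_{r,\nu}(x)=(-1)^n\frac{1}{r|x|}h(r|x|)$ for $x\in[-1,0)$. Since $f$ is an element of $\mathcal{L}^2$, the reconstruction formula is an equality for almost every $s$. *)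

(* Defs.v *)
From HB Require Import structures.
From mathcomp Require Import all_boot all_order all_algebra.
From mathcomp Require Import complex.
From mathcomp Require Import all_classical all_reals all_analysis.

Set Implicit Arguments.
Unset Strict Implicit.
Unset Printing Implicit Defensive.
Import Order.TTheory GRing.Theory Num.Theory.
Import numFieldNormedType.Exports.

Local Open Scope classical_set_scope.
Local Open Scope ring_scope.
Local Open Scope complex_scope.

(** The analysis library has no calculus for functions with values in [R[i]]:
    measurability, integrals, limits and derivatives of a complex-valued
    function of a real variable are taken on the real and imaginary parts. *)

Section ComplexValued.
Context {R : realType}.
Implicit Types (D : set R) (f : R -> R[i]).

Definition sqnorm (z : R[i]) : R := complex.Re z ^+ 2 + complex.Im z ^+ 2.

Definition cis (t : R) : R[i] := cos t +i* sin t.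

Definition cintegral D f : R[i] :=
  (\int[lebesgue_measure]_(x in D) complex.Re (f x)) +i*
  (\int[lebesgue_measure]_(x in D) complex.Im (f x)).

Definition cmeasurable D f : Prop :=
  measurable_fun D (fun x => complex.Re (f x)) /\
  measurable_fun D (fun x => complex.Im (f x)).

(** Membership in L^2(D); elements of L^2 are represented by functions, and
    equality in L^2 is written out as equality almost everywhere. *)
Definition inL2 D f : Prop :=
  cmeasurable D f /\
  (\int[lebesgue_measure]_(x in D) (sqnorm (f x))%:E < +oo)%E.

Definition cvgL2 D (u : nat -> R -> R[i]) f : Prop :=
  (\int[lebesgue_measure]_(x in D) (sqnorm (u N x - f x))%:E)%E
    @[N --> \oo] --> (0 : R)%:E.

Definition clim (F : set_system R) f : R[i] :=
  lim (complex.Re (f x) @[x --> F]) +i* lim (complex.Im (f x) @[x --> F]).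

Definition twice_derivable (g : R -> R) (x : R) : Prop :=
  (\forall y \near x, derivable g y 1) /\ derivable (derive1 g) x 1.

Definition ctwice_derivable f (x : R) : Prop :=
  twice_derivable (fun y => complex.Re (f y)) x /\
  twice_derivable (fun y => complex.Im (f y)) x.

Definition cderive2 f (x : R) : R[i] :=
  derive1n 2 (fun y => complex.Re (f y)) x +i*
  derive1n 2 (fun y => complex.Im (f y)) x.

End ComplexValued.

Section SpecialFunctions.
Context {R : realType}.

(** Rodrigues' formula. *)
Definition legendre (n : nat) : {poly R} :=
  (2 ^+ n * n`!%:R)^-1 *: (('X ^+ 2 - 1) ^+ n)^`(n).

(** Euler's integral, meaningful for [0 < a]. *)
Definition Gamma (a : R) : R :=
  \int[lebesgue_measure]_(t in `[0, +oo[) (t `^ (a - 1) * expR (- t)).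

(** The Bessel function of the first kind J_nu(x) by its power series, for
    [-1 < nu] (so that every Gamma value is given by Euler's integral) and
    [0 <= x] (so that [powR] is the usual power). *)
Definition besselJ (nu x : R) : R :=
  limn (series (fun k : nat =>
    (-1) ^+ k / (k`!%:R * Gamma (k%:R + nu + 1)) * (x / 2) `^ (2 * k%:R + nu))).

End SpecialFunctions.

Section Transforms.
Context {R : realType}.

Definition hankel (nu : R) (f : R -> R[i]) (t : R) : R[i] :=
  cintegral `[0, +oo[
    (fun s => f s * (besselJ nu (t * s) * Num.sqrt (t * s))%:C).

Definition Fc (c : R) (f : R -> R[i]) (x : R) : R[i] :=
  cintegral `[-1, 1] (fun y => cis (c * x * y) * f y).

(** The coefficient of [f] along [psi]; no conjugation is needed because [psi]
    is real-valued. *)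
Definition coefL2 (psi : R -> R) (f : R -> R[i]) : R[i] :=
  cintegral `[-1, 1] (fun x => (psi x)%:C * f x).

(** [psi] is a system of prolate spheroidal wave functions of parameter [c],
    with eigenvalues [lam]. *)
Record is_pswf (c : R) (psi : nat -> R -> R) (lam : nat -> R[i]) : Prop := {
  pswf_L2 : forall j, inL2 `[-1, 1] (fun x => (psi j x)%:C) ;
  pswf_orthonormal : forall i j,
    \int[lebesgue_measure]_(x in `[-1, 1]) (psi i x * psi j x) = (i == j)%:R ;
  pswf_basis : forall f, inL2 `[-1, 1] f ->
    cvgL2 `[-1, 1]
      (fun N x => \sum_(j < N) coefL2 (psi j) f * (psi j x)%:C) f ;
  pswf_eigen : forall j, {ae lebesgue_measure, forall x : R, -1 <= x <= 1 ->
    Fc c (fun y => (psi j y)%:C) x = lam j * (psi j x)%:C} ;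
  pswf_decr : forall j, 0 < `|lam j.+1| < `|lam j|
}.

(** [phi] represents F_c^{-1}[g], the sum in L^2([-1,1]) of the series
    sum_j lam_j^{-1} psi_j <psi_j, g>. *)
Definition is_Fc_inv (psi : nat -> R -> R) (lam : nat -> R[i])
    (g phi : R -> R[i]) : Prop :=
  inL2 `[-1, 1] phi /\
  cvgL2 `[-1, 1]
    (fun N y => \sum_(j < N) (lam j)^-1 * (psi j y)%:C * coefL2 (psi j) g) phi.

(** The function h_{r,nu} with [n = nu - 1/2]; only its values on [-1, 1] are
    relevant. *)
Definition h_ext (n : nat) (r : R) (h : R -> R[i]) (x : R) : R[i] :=
  let eps : R[i] := -1 in
  if x == 0 then clim 0^'+ (fun y => ((r * y)^-1)%:C * h (r * y))
  else if 0 < x then ((r * x)^-1)%:C * h (r * x)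
  else (-1) ^+ n * ((r * x)^-1)%:C * h (- (r * x)) * eps.

(** The function of [s] whose second derivative enters the formula. *)
Definition legendre_tail (n : nat) (sigma : R) (phi : R -> R[i]) (s : R)
    : R[i] :=
  cintegral `[s, sigma]
    (fun t => (s * (legendre n).[t / s] / t ^+ 2)%:C * phi (t / sigma)).

End Transforms.

(* Main.v *)
Require Import Defs.
From HB Require Import structures.
From mathcomp Require Import all_boot all_order all_algebra.
From mathcomp Require Import complex ring lra zify.
From mathcomp Require Import all_classical all_reals all_analysis.
From mathcomp Require Import measurable_realfun.

(** The formula holds because each of the two integral transforms involved has a
    kernel that is explicit when nu = n + 1/2.

    The transform side.  For x >= 0,
      sqrt(x) J_nu(x) = x / sqrt(2 pi) S_n(x),
      int_{-1}^1 e^{ixu} P_n(u) du = i^n S_n(x),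
    for one and the same real function S_n ([spherical] below; it is twice the
    spherical Bessel function j_n).  Both identities are read off power series:
    the moments of P_n follow from Rodrigues' formula by integrating by parts,
    and Gamma(m + 3/2) from the Gauss integral ([besselJ_half],
    [Rintegral_cos_legendre], [Rintegral_sin_legendre]).  Writing S_n(ts) in
    h(t) as such an integral, substituting y = su/sigma and exchanging the two
    integrals shows that, for x <> 0,
      h_{r,nu}(x) = F_c[phi](x),
      phi(y) = C int_{sigma|y|}^sigma f(s) P_n(sigma y / s) ds,
      C = (-i)^n sigma / sqrt(2 pi)
    ([h_ext_profile]; [profile] is this integral).  The kernel of F_c is
    symmetric, so <psi_j, F_c phi> = lam_j <psi_j, phi>; the series for F_c^{-1}
    is therefore the expansion of phi in the basis psi_j ([is_Fc_inv_profile]),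
    and by uniqueness of limits in L^2 any function it represents is phi almost
    everywhere ([cvgL2_unique]).

    The inversion.  Everything rests on the identity, for 0 < s <= t,
      int_s^t P_n(x/s) P_n(x/t) x^{-2} dx = 1/s - 1/t,
    in which the degree n has disappeared ([Rintegral_legendre_kernel]).  To see
    it, integrate term by term: the result is a combination of the numbers
      A_k = sum_l p_l / (k + l - 1),   P_n = sum_l p_l x^l,
    and A_k is a finite part of int_0^1 P_n(x) x^{k-2} dx, hence vanishes by
    orthogonality for 2 <= k <= n of the parity of n.  Only one product p_k A_k,
    with k = 0 or 1, is left, and sum_k (2k - 1) p_k A_k = P_n(1)^2 = 1 gives its
    value ([legendre_fp_mul]).  Exchanging integrals again, the integral in the
    reconstruction formula becomes
      C int_s^sigma f(t) (1 - s/t) dt = C int_s^sigma int_u^sigma f(t)/t dt du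
    ([legendre_tail_real], [tail_fubini]).  It is differentiable with a
    continuous derivative, and Lebesgue's differentiation theorem identifies the
    second derivative with C f(s)/s for almost every s ([ae_tail_derivable]).

    Uniqueness of f follows: two functions with the same h on [0, r] have the
    same coefficients <psi_j, h_{r,nu}>, so one phi reconstructs both. *)

Set Implicit Arguments.
Unset Strict Implicit.
Unset Printing Implicit Defensive.
Import Order.TTheory GRing.Theory Num.Theory.
Import numFieldNormedType.Exports.

Local Open Scope classical_set_scope.
Local Open Scope ring_scope.
Local Open Scope complex_scope.

(** * Formal integration of polynomials *)

Section PolynomialIntegral.
Context {R : realType}.
Implicit Types (p q w : {poly R}) (a b x : R) (n k m : nat).

Definition antideriv p : {poly R} :=
  \poly_(i < (size p).+1) (p`_i.-1 / i%:R).

Lemma coef_antideriv p i : (antideriv p)`_i = p`_i.-1 / i%:R.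
Proof.
rewrite coef_poly; case: ltnP => // h; rewrite nth_default ?mul0r//.
by case: i h => // i; rewrite ltnS.
Qed.

Lemma deriv_antideriv p : (antideriv p)^`() = p.
Proof.
apply/polyP => i; rewrite coef_deriv coef_antideriv /=.
by rewrite -[LHS]mulr_natr divfK// pnatr_eq0.
Qed.

Lemma antideriv_deriv p : antideriv p^`() = p - (p`_0)%:P.
Proof.
apply/polyP => -[|i]; rewrite coef_antideriv coefB coefC /=.
  by rewrite subrr invr0 mulr0.
by rewrite subr0 coef_deriv -[X in X / _]mulr_natr mulfK// pnatr_eq0.
Qed.

Lemma antideriv_is_linear : linear antideriv.
Proof.
move=> c p q; apply/polyP => i.
by rewrite !(coefD, coefZ, coef_antideriv) mulrDl mulrA.
Qed.

HB.instance Definition _ :=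
  GRing.isLinear.Build R {poly R} {poly R} *:%R antideriv antideriv_is_linear.

(** Integrals of polynomials, as evaluations of an antiderivative: linear and
    compatible with integration by parts by pure algebra, without
    integrability side conditions. *)
Definition polyint a b p : R := (antideriv p).[b] - (antideriv p).[a].

Lemma polyint_is_scalar a b : scalar (polyint a b).
Proof.
move=> c p q; rewrite /polyint linearD linearZ !hornerE /=.
by ring.
Qed.

HB.instance Definition _ a b :=
  GRing.isLinear.Build R {poly R} R *%R (polyint a b) (polyint_is_scalar a b).

Lemma polyint_deriv a b p : polyint a b p^`() = p.[b] - p.[a].
Proof. by rewrite /polyint antideriv_deriv !hornerE; ring. Qed.

Lemma polyintXn a b n :
  polyint a b 'X^n = (b ^+ n.+1 - a ^+ n.+1) / n.+1%:R.
Proof.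
have -> : ('X^n : {poly R}) = (n.+1%:R^-1 *: 'X^(n.+1))^`().
  by rewrite derivZ derivXn /= -[X in _ *: X]scaler_nat scalerA mulVf ?scale1r ?pnatr_eq0.
by rewrite polyint_deriv !hornerE /=; ring.
Qed.

Lemma polyint_by_parts a b p q : polyint a b (p^`() * q) =
  (p * q).[b] - (p * q).[a] - polyint a b (p * q^`()).
Proof. by rewrite -polyint_deriv derivM linearD /=; ring. Qed.

Lemma polyint_by_parts_iter a b w q n :
  (forall j, (j < n)%N -> root (w^`(j)) a && root (w^`(j)) b) ->
  polyint a b (w^`(n) * q) = (-1) ^+ n * polyint a b (w * q^`(n)).
Proof.
elim: n q => [|n IH] q hw; first by rewrite !derivn0 mul1r.
rewrite derivnS polyint_by_parts; have /andP[/rootP wa /rootP wb] := hw n (leqnn _).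
rewrite !hornerM wa wb !mul0r subrr sub0r IH; last by move=> j jn; apply: hw; exact: ltnW.
by rewrite -derivSn exprS mulN1r mulNr.
Qed.

(** Each derivative lowers the multiplicity of the root c by one.  The case j < m
    gives the boundary terms in the integrations by parts, j = m gives P_n(1). *)
Lemma derivn_XsubC_mul c m j q : (j <= m)%N ->
  exists2 q', (('X - c%:P) ^+ m * q)^`(j) = ('X - c%:P) ^+ (m - j) * q' &
    q'.[c] = (m ^_ j)%:R * q.[c].
Proof.
elim: j => [|j IH] jm.
  by exists q; rewrite ?derivn0 ?subn0// ffactn0 mul1r.
have [q' e h] := IH (ltnW jm).
exists (q' *+ (m - j) + ('X - c%:P) * q'^`()).
  rewrite derivnS e derivM deriv_exp derivXsubC mul1r.
  rewrite (_ : m - j = (m - j.+1).+1)%N; last by rewrite -subSn.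
  by rewrite -pred_Sn exprS mulrnAl mulrDr mulrnAr mulrCA mulrA.
rewrite hornerD hornerM hornerMn h !hornerE subrr mul0r addr0 ffactnSr natrM.
by rewrite -mulr_natr; ring.
Qed.

End PolynomialIntegral.

(** * Legendre polynomials *)

Section Legendre.
Context {R : realType}.
Implicit Types (p q w : {poly R}) (a b x : R) (n k m j : nat).
Local Notation P n := (@legendre R n).
Local Notation W n := (('X ^+ 2 - 1 : {poly R}) ^+ n).

Lemma legendre_weightE n :
  W n = ('X - 1%:P) ^+ n * ('X - (-1)%:P) ^+ n.
Proof. by rewrite -exprMn; congr (_ ^+ n); rewrite polyCN opprK; ring. Qed.

Lemma root_derivn_weight n j : (j < n)%N ->
  root ((W n)^`(j)) (-1) && root ((W n)^`(j)) 1.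
Proof.
move=> jn; rewrite legendre_weightE; apply/andP; split; apply/rootP.
  rewrite mulrC.
  have [q' -> _] := @derivn_XsubC_mul R (-1) n j (('X - 1%:P) ^+ n) (ltnW jn).
  by rewrite hornerM horner_exp !hornerE subrr expr0n subn_eq0 leqNgt jn mul0r.
have [q' -> _] := @derivn_XsubC_mul R 1 n j (('X - (-1)%:P) ^+ n) (ltnW jn).
by rewrite hornerM horner_exp !hornerE subrr expr0n subn_eq0 leqNgt jn mul0r.
Qed.

(** Near 1 the weight (X^2 - 1)^n is (X - 1)^n (X + 1)^n; the n-th derivative at
    1 only sees n! (1 + 1)^n. *)
Lemma legendre_at1 n : (P n).[1] = 1.
Proof.
rewrite /legendre hornerZ legendre_weightE.
have [q' -> h] := @derivn_XsubC_mul R 1 n n (('X - (-1)%:P) ^+ n) (leqnn n).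
rewrite subnn expr0 mul1r h ffactnn horner_exp hornerXsubC opprK -[1 + 1]/2.
by rewrite [X in _ * X]mulrC mulVf// mulf_neq0 ?expf_neq0 ?pnatr_eq0// -lt0n fact_gt0.
Qed.

Lemma coef_weight_odd n j : odd j -> (W n)`_j = 0.
Proof.
have -> : W n = (('X - 1) ^+ n) \Po 'X^2.
  by rewrite rmorphXn rmorphB /= comp_polyX rmorph1.
by rewrite coef_comp_poly_Xn// dvdn2 => ->.
Qed.

Lemma legendre_parity n k : odd (n + k) -> (P n)`_k = 0.
Proof. by move=> o; rewrite /legendre coefZ coef_derivn coef_weight_odd// mul0rn mulr0. Qed.

Lemma size_legendre n : (size (P n) <= n.+1)%N.
Proof.
apply/leq_sizeP => j nj; rewrite /legendre coefZ coef_derivn nth_default ?mul0rn ?mulr0//.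
apply: leq_trans (size_poly_exp_leq _ _) _.
have : (size ('X ^+ 2 - 1 : {poly R})%R <= 3)%N.
  by apply: leq_trans (size_polyD _ _) _; rewrite size_polyN size_polyXn size_poly1.
set s := size _ => s3; have : (s.-1 * n <= 2 * n)%N by rewrite leq_mul2r; lia.
lia.
Qed.

Definition legendre_moment n j : R := polyint (-1) 1 (P n * 'X^j).

(** Rodrigues' formula and n integrations by parts; the weight vanishes to order
    n at both ends. *)
Lemma legendre_momentE n j : legendre_moment n j =
  (2 ^+ n * n`!%:R)^-1 * (-1) ^+ n * (j ^_ n)%:R * polyint (-1) 1 (W n * 'X^(j - n)).
Proof.
rewrite /legendre_moment /legendre -scalerAl linearZ /=.
rewrite polyint_by_parts_iter; last by move=> i; exact: root_derivn_weight.
by rewrite derivnXn [X in polyint _ _ X]mulrnAr raddfMn /= -[X in _ * (_ * X)]mulr_natr; ring.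
Qed.

Lemma legendre_moment_small n j : (j < n)%N -> legendre_moment n j = 0.
Proof. by move=> jn; rewrite legendre_momentE ffact_small// mulr0 mul0r. Qed.

Lemma polyintE a b p m : (size p <= m)%N ->
  polyint a b p = \sum_(i < m) p`_i * ((b ^+ i.+1 - a ^+ i.+1) / i.+1%:R).
Proof.
move=> sp; rewrite [p in LHS](_ : p = \sum_(i < m) p`_i *: 'X^i); last first.
  rewrite -poly_def; apply/polyP => i; rewrite coef_poly; case: ltnP => // mi.
  by rewrite nth_default// (leq_trans sp).
by rewrite linear_sum; apply: eq_bigr => i _; rewrite linearZ /= polyintXn.
Qed.

Lemma legendre_moment_odd n j : odd (n + j) -> legendre_moment n j = 0.
Proof.
move=> o; rewrite /legendre_moment (polyintE _ _ (leqnn _)) big1// => i _.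
rewrite coefMXn; case: ltnP => ij; first by rewrite mul0r.
case oi: (odd i).
  by rewrite -signr_odd /= oi /= expr0 expr1n subrr mul0r mulr0.
by rewrite legendre_parity ?mul0r//; move: o oi; lia.
Qed.

(** The beta integral B(k + 1/2, n + 1).  Induction on n through
    (1 - u^2)^(n+1) u^(2k) = (1 - u^2)^n u^(2k) - (1 - u^2)^n u^(2k+2). *)
Lemma polyint_beta n k :
  polyint (-1) 1 ((1 - 'X^2) ^+ n * 'X^(2 * k)) =
  n`!%:R / \prod_(i < n.+1) (k%:R + i%:R + 2^-1) :> R.
Proof.
have pos m k' : \prod_(i < m) (k'%:R + i%:R + 2^-1) != 0 :> R.
  by apply/prodf_neq0 => i _; rewrite gt_eqF// ltr_wpDl ?invr_gt0// addr_ge0.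
elim: n k => [|n IH] k.
  rewrite expr0 mul1r polyintXn big_ord_recl big_ord0 mulr1 addr0 expr1n.
  rewrite -signr_odd /= mul2n odd_double /= expr1 -natr1 -mul2n natrM.
  rewrite fact0 opprK.
  have k0 : k%:R + 2^-1 != 0 :> R by rewrite gt_eqF// ltr_wpDl ?invr_gt0.
  have -> : 2 * k%:R + 1 = 2 * (k%:R + 2^-1) :> R by field.
  by rewrite invfM mulrA divff// mul1r.
rewrite (_ : _ * _ = (1 - 'X^2) ^+ n * 'X^(2 * k) - (1 - 'X^2) ^+ n * 'X^(2 * k.+1)); last first.
  by rewrite mulnS exprD exprS; ring.
rewrite linearB /= !IH.
have e1 : \prod_(i < n.+2) (k%:R + i%:R + 2^-1) =
    \prod_(i < n.+1) (k%:R + i%:R + 2^-1) * (k%:R + n.+1%:R + 2^-1) :> R.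
  by rewrite big_ord_recr.
have e2 : \prod_(i < n.+2) (k%:R + i%:R + 2^-1) =
    \prod_(i < n.+1) (k.+1%:R + i%:R + 2^-1) * (k%:R + 2^-1) :> R.
  rewrite big_ord_recl /= addr0 mulrC; congr (_ * _); apply: eq_bigr => i _.
  by rewrite /= -!natr1; ring.
have p1 := pos n.+1 k; have p2 := pos n.+1 k.+1; have p3 := pos n.+2 k.
have a0 : k%:R + n.+1%:R + 2^-1 != 0 :> R by rewrite gt_eqF// ltr_wpDl ?invr_gt0// addr_ge0.
have b0 : k%:R + 2^-1 != 0 :> R by rewrite gt_eqF// ltr_wpDl ?invr_gt0.
rewrite (_ : n`!%:R / \prod_(i < n.+1) (k%:R + i%:R + 2^-1) =
  n`!%:R * (k%:R + n.+1%:R + 2^-1) / \prod_(i < n.+2) (k%:R + i%:R + 2^-1)); last first.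
  by rewrite e1 -mulf_div divff // mulr1.
rewrite (_ : n`!%:R / \prod_(i < n.+1) (k.+1%:R + i%:R + 2^-1) =
  n`!%:R * (k%:R + 2^-1) / \prod_(i < n.+2) (k%:R + i%:R + 2^-1)); last first.
  by rewrite e2 -mulf_div divff // mulr1.
by rewrite -mulrBl factS natrM; congr (_ / _); ring.
Qed.

Lemma legendre_moment_even n k : legendre_moment n (n + 2 * k) =
  (n + 2 * k)`!%:R /
    ((2 * k)`!%:R * 2 ^+ n * \prod_(i < n.+1) (k%:R + i%:R + 2^-1)).
Proof.
rewrite legendre_momentE [(n + 2 * k)%N]addnC addnK.
have -> : W n = (-1) ^+ n *: (1 - 'X^2) ^+ n.
  by rewrite -exprZn scaleN1r opprB.
rewrite -[X in polyint _ _ X]scalerAl [polyint _ _ _]linearZ /= polyint_beta.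
rewrite -(@ffact_fact (2 * k + n) n) ?leq_addl// addnK natrM.
have f0 m : m`!%:R != 0 :> R by rewrite pnatr_eq0 -lt0n fact_gt0.
have s1 : (-1) ^+ n * (-1) ^+ n = 1 :> R by rewrite -exprD -signr_odd oddD addbb.
rewrite !invfM -[RHS]mul1r -[X in _ = X * _]s1 -[RHS]mul1r -[X in _ = X * _](divff (f0 n)).
rewrite -[LHS]mulr1 -[X in _ * X = _](divff (f0 (2 * k)%N)).
by ring.
Qed.

Lemma legendre_sumE n : P n = \sum_(l < n.+1) (P n)`_l *: 'X^l.
Proof.
rewrite -poly_def; apply/polyP => i; rewrite coef_poly; case: ltnP => // ni.
by rewrite nth_default// (leq_trans (size_legendre n)).
Qed.

(** The numbers A_k: formally int_0^1 P_n(x) x^(k-2) dx, where for k < 2 the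
    divergent part at 0 is dropped. *)
Definition legendre_fp n k : R :=
  \sum_(l < n.+1) (P n)`_l / (k%:R + l%:R - 1).

(** For k >= 2 the integral converges, and x^(k-2) has the parity of P_n, so it
    is half of the integral over [-1, 1], an orthogonality relation. *)
Lemma legendre_fp_eq0 n k : (1 < k <= n)%N -> ~~ odd (n + k) -> legendre_fp n k = 0.
Proof.
move=> /andP[k1 kn] o.
have m0 : legendre_moment n (k - 2) = 0 by apply: legendre_moment_small; lia.
apply: (mulfI (x := 2)); first by rewrite pnatr_eq0.
rewrite mulr0 -[RHS]m0 /legendre_moment [in RHS]legendre_sumE mulr_suml linear_sum mulr_sumr.
apply: eq_bigr => l _.
rewrite -scalerAl linearZ /= -exprD polyintXn expr1n.
have [pl|pl] := eqVneq (P n)`_l 0; first by rewrite pl !mul0r mulr0.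
have ol : ~~ odd (n + l) by apply: contra_neqN pl; exact: legendre_parity.
rewrite -signr_odd (_ : odd _ = true); last by move: o ol k1; lia.
rewrite (_ : (l + (k - 2)).+1%:R = k%:R + l%:R - 1 :> R); last first.
  by apply: (addIr 1); rewrite subrK natr1 -natrD; congr (_%:R); move: k1; lia.
by rewrite expr1; ring.
Qed.

(** The sum is symmetrised in (k, l): 2k - 1 becomes k + l - 1, which cancels the
    denominator and leaves P_n(1)^2.  The denominator can only vanish when
    k + l is odd, where p_k p_l = 0. *)
Lemma legendre_fp_sum1 n :
  \sum_(k < n.+1) (2 * k%:R - 1) * ((P n)`_k * legendre_fp n k) = 1.
Proof.
have P1 : \sum_(l < n.+1) (P n)`_l = 1.
  by rewrite -(legendre_at1 n) [in RHS]legendre_sumE horner_sum; apply: eq_bigr => l _;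
    rewrite !hornerE expr1n mulr1.
have -> : \sum_(k < n.+1) (2 * k%:R - 1) * ((P n)`_k * legendre_fp n k) =
  \sum_(k < n.+1) \sum_(l < n.+1)
   (k%:R + l%:R - 1) * ((P n)`_k * (P n)`_l / (k%:R + l%:R - 1)).
  have sw : \sum_(k < n.+1) \sum_(l < n.+1) k%:R * ((P n)`_k * (P n)`_l / (k%:R + l%:R - 1))
    = \sum_(k < n.+1) \sum_(l < n.+1) l%:R * ((P n)`_k * (P n)`_l / (k%:R + l%:R - 1)).
    rewrite exchange_big /=; apply: eq_bigr => k _; apply: eq_bigr => l _.
    by rewrite [l%:R + k%:R]addrC [(P n)`_l * _]mulrC.
  transitivity (\sum_(k < n.+1) \sum_(l < n.+1) k%:R * ((P n)`_k * (P n)`_l / (k%:R + l%:R - 1))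
    + \sum_(k < n.+1) \sum_(l < n.+1) (k%:R - 1) * ((P n)`_k * (P n)`_l / (k%:R + l%:R - 1))).
    rewrite -big_split; apply: eq_bigr => k _ /=.
    rewrite /legendre_fp -big_split !mulr_sumr; apply: eq_bigr => l _ /=.
    by ring.
  rewrite sw -big_split; apply: eq_bigr => k _ /=.
  by rewrite -big_split; apply: eq_bigr => l _ /=; ring.
rewrite -[RHS]mulr1 -[in RHS]P1 big_distrl /=; apply: eq_bigr => k _.
rewrite mulr_sumr; apply: eq_bigr => l _.
have [od|ev] := boolP (odd (k + l)).
  have : odd (n + k) || odd (n + l) by move: od; lia.
  by case/orP => /legendre_parity ->; rewrite !(mul0r,mulr0).
rewrite mulrCA divff ?mulr1// -natrD subr_eq0 -[1]/(1%:R) eqr_nat.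
by apply: contraNneq ev => ->.
Qed.

(** The only k in {0, 1} of the parity of n is k = odd n; for it 2k - 1 = 1 or -1
    is its own inverse. *)
Lemma legendre_fp_mul n k : (k <= n)%N ->
  (P n)`_k * legendre_fp n k = (k == odd n)%:R * (2 * (odd n)%:R - 1).
Proof.
have z j : (j <= n)%N -> j != odd n -> (P n)`_j * legendre_fp n j = 0.
  move=> jn je; have [od|ev] := boolP (odd (n + j)).
    by rewrite legendre_parity// mul0r.
  by rewrite legendre_fp_eq0 ?mulr0//; move: je ev jn; lia.
move=> kn; have [->|kne] := eqVneq k (nat_of_bool (odd n)); last by rewrite z// mul0r.
have en : (odd n < n.+1)%N by rewrite ltnS -[X in (_ <= X)%N](odd_double_half n) leq_addr.
have := legendre_fp_sum1 n.
rewrite (bigD1 (inord (odd n) : 'I_n.+1))//= big1 ?addr0; last first.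
  move=> i hi; rewrite z ?mulr0 ?leq_ord//.
  by apply: contra_neq hi => hi; apply: val_inj; rewrite /= inordK.
rewrite inordK// => h; rewrite mul1r.
have h2 : (2 * (odd n)%:R - 1) * (2 * (odd n)%:R - 1) = 1 :> R.
  by case: (odd n) => /=; ring.
by rewrite -[LHS]mul1r -[X in X * _ = _]h2 -mulrA h mulr1.
Qed.

(** The integral of P_n(x/s) P_n(x/t) x^(-2) over [s, t], evaluated termwise:
    each half of the double sum factors through the products p_k A_k. *)
Lemma legendre_kernel_sum n (s t : R) : s != 0 -> t != 0 ->
  \sum_(k < n.+1) \sum_(l < n.+1) (P n)`_k * (P n)`_l / (k%:R + l%:R - 1) *
    ((t / s) ^+ k / t - (s / t) ^+ l / s) = s^-1 - t^-1.
Proof.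
move=> s0 t0.
have fs (z : nat -> R) : \sum_(k < n.+1) (P n)`_k * legendre_fp n k * z k =
    (2 * (odd n)%:R - 1) * z (odd n).
  have en : (odd n < n.+1)%N by rewrite ltnS -[X in (_ <= X)%N](odd_double_half n) leq_addr.
  rewrite (bigD1 (inord (odd n) : 'I_n.+1))//= big1 ?addr0; last first.
    move=> i hi; rewrite legendre_fp_mul ?leq_ord//.
    rewrite (_ : (i == _ :> nat) = false) ?mul0r//.
    by apply: contra_neqF hi => /eqP hi; apply: val_inj; rewrite /= inordK.
  by rewrite legendre_fp_mul ?leq_ord// inordK// eqxx mul1r.
transitivity (\sum_(k < n.+1) (P n)`_k * legendre_fp n k * ((t / s) ^+ k / t) -
  \sum_(k < n.+1) (P n)`_k * legendre_fp n k * ((s / t) ^+ k / s)).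
  transitivity (\sum_(k < n.+1) \sum_(l < n.+1) (P n)`_k * (P n)`_l / (k%:R + l%:R - 1) *
      ((t / s) ^+ k / t) - \sum_(k < n.+1) \sum_(l < n.+1)
        (P n)`_k * (P n)`_l / (k%:R + l%:R - 1) * ((s / t) ^+ l / s)).
    rewrite -sumrB; apply: eq_bigr => k _; rewrite -sumrB; apply: eq_bigr => l _.
    by rewrite mulrBr.
  congr (_ - _).
    apply: eq_bigr => k _; rewrite mulr_sumr mulr_suml; apply: eq_bigr => l _.
    by rewrite mulrA.
  rewrite exchange_big /=.
  apply: eq_bigr => k _; rewrite mulr_sumr mulr_suml; apply: eq_bigr => l _.
  by rewrite [l%:R + _]addrC mulrA [(P n)`_l * _]mulrC.
rewrite (fs (fun k => (t / s) ^+ k / t)) (fs (fun k => (s / t) ^+ k / s)).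
case: (odd n) => /=; rewrite ?expr0 ?expr1.
  by field; rewrite s0 t0.
by field; rewrite s0 t0.
Qed.

End Legendre.

(** * Integrals of continuous functions *)

Section IntegralTools.
Context {R : realType}.
Notation mu := (@lebesgue_measure R).
Implicit Types (f g F : R -> R) (a b x : R).

Lemma continuous_itv_integrable f a b :
  {in `[a, b]%classic, forall x, {for x, continuous f}} ->
  mu.-integrable `[a, b] (EFin \o f).
Proof.
move=> cf; apply: continuous_compact_integrable; first exact: segment_compact.
exact: continuous_in_subspaceT.
Qed.

Lemma Rintegral_FTC f F a b : a <= b ->
  {in `[a, b]%classic, forall x, {for x, continuous f}} ->
  {in `[a, b]%classic, forall x, is_derive x 1 F (f x)} ->
  \int[mu]_(x in `[a, b]) f x = F b - F a.
Proof.
rewrite le_eqVlt => /predU1P[->|ab] cf dF.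
  by rewrite set_itv1 Rintegral_set1 subrr.
have dF' x : x \in `[a, b] -> is_derive x 1 F (f x).
  by move=> xab; apply: dF; rewrite inE.
have cF x : x \in `[a, b] -> {for x, continuous F}.
  move=> xab; apply/differentiable_continuous/derivable1_diffP.
  by have [] := dF' _ xab.
rewrite /Rintegral (@continuous_FTC2 _ f F a b)// -?EFinB//.
- exact: continuous_in_subspaceT.
- split.
  + by move=> x xab; have [] := dF' x (subset_itv_oo_cc xab).
  + by apply: cvg_at_right_filter; apply: cF; rewrite in_itv /= lexx ltW.
  + by apply: cvg_at_left_filter; apply: cF; rewrite in_itv /= lexx ltW.
- move=> x xab; have d := dF' x (subset_itv_oo_cc xab).
  by rewrite derive1E derive_val.
Qed.

(** The bridge from formal to Lebesgue integrals of polynomials. *)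
Lemma Rintegral_horner (p : {poly R}) a b : a <= b ->
  \int[mu]_(x in `[a, b]) p.[x] = polyint a b p.
Proof.
move=> ab; rewrite (@Rintegral_FTC _ (horner (antideriv p)))//.
  by move=> x _; exact: continuous_horner.
by move=> x _; rewrite -{2}(deriv_antideriv p); exact: is_derive_poly.
Qed.

End IntegralTools.

(** * The Gamma function at half-integers *)

Section GammaHalf.
Context {R : realType}.
Notation mu := (@lebesgue_measure R).

(** Truncated at an integer: the boundary terms of the integrations by parts are
    then finite, and the recurrence survives the limit. *)
Definition gauss_moment (m n : nat) : R :=
  \int[mu]_(x in `[0, n%:R]) (x ^+ (2 * m) * gauss_fun x).

Lemma continuous_gauss_moment m (x : R) :
  {for x, continuous (fun x : R => x ^+ m * gauss_fun x)}.
Proof.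
apply: (@continuousM _ R^o); first exact: exprn_continuous.
exact: continuous_gauss_fun.
Qed.

(** The derivative of x^(2m+1) e^(-x^2), integrated over [0, n]. *)
Lemma gauss_moment_recl m n :
  2 * gauss_moment m.+1 n =
  (2 * m + 1)%:R * gauss_moment m n - n%:R ^+ (2 * m + 1) * gauss_fun n%:R.
Proof.
have n0 : (0 : R) <= n%:R by [].
pose F x : R := x ^+ (2 * m + 1) * gauss_fun x.
pose f x : R := (2 * m + 1)%:R * (x ^+ (2 * m) * gauss_fun x) - 2 * (x ^+ (2 * m.+1) * gauss_fun x).
have dF (x : R) : is_derive x 1 F (f x).
  rewrite (_ : F = (id ^+ (2 * m + 1)) * (expR \o - (id ^+ 2))); last first.
    by apply/funext => y; rewrite /F /gauss_fun !fctE.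
  apply: trigger_derive.
  rewrite /f /gauss_fun !fctE /GRing.scale /= addn1 mulnS exprS exprD /=; ring.
have cf k : {in `[0, n%:R]%classic,
    forall x : R, {for x, continuous (fun x : R => x ^+ k * gauss_fun x)}}.
  by move=> x _; exact: continuous_gauss_moment.
have icf k := continuous_itv_integrable (cf k).
have : \int[mu]_(x in `[0, n%:R]) f x = F n%:R - F 0.
  apply: Rintegral_FTC => // x _.
  apply: (@continuousB _ R^o); apply: (@continuousM _ R^o); (try exact: cst_continuous);
   exact: continuous_gauss_moment.
rewrite /f RintegralB//; first last.
- by apply: (@integrableZl _ _ _ mu _ _ 2 (EFin \o (fun x : R => x ^+ (2 * m.+1) * gauss_fun x))).
- by apply: (@integrableZl _ _ _ mu _ _ (2 * m + 1)%:R
    (EFin \o (fun x : R => x ^+ (2 * m) * gauss_fun x))).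
rewrite RintegralZl// RintegralZl// -!/(gauss_moment _ _) {2}/F addn1 exprS !mul0r subr0 => h.
have -> : n%:R ^+ (2 * m).+1 * gauss_fun n%:R = F n%:R by rewrite /F addn1.
by rewrite -h; ring.
Qed.

(** e^(x^2) is at least x^(2m+2) / (m+1)!, so the boundary term is O(1/x). *)
Lemma cvg_gauss_boundary m :
  n%:R ^+ (2 * m + 1) * gauss_fun n%:R @[n --> \oo] --> (0 : R).
Proof.
rewrite -cvg_shiftS /=.
apply: (@squeeze_cvgr _ _ _ _ (fun=> 0) (fun n => m.+1`!%:R * harmonic n)).
- near=> n; rewrite mulr_ge0 ?exprn_ge0 ?gauss_fun_ge0//=.
  set x : R := n.+1%:R; have x0 : 0 < x by rewrite ltr0n.
  have := @expR_ge1Dxn R (x ^+ 2) m (exprn_ge0 _ (ltW x0)).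
  move=> /(lt_le_trans (ltr_pwDl ltr01 (lexx _))) /ltW.
  rewrite ler_pdivrMr ?ltr0n ?fact_gt0// /gauss_fun expRN => h.
  rewrite ler_pdivrMr ?expR_gt0// mulrAC ler_pdivlMr//.
  by rewrite -exprSr [leRHS]mulrC addn1 (_ : (2 * m).+2 = (2 * m.+1)%N) ?mulnS // -mulnS exprM.
- exact: cvg_cst.
- by rewrite -[X in _ --> X](mulr0 m.+1`!%:R); apply: cvgMl_tmp; exact: cvg_harmonic.
Unshelve. all: by end_near. Qed.

Lemma cvg_gauss_moment m : gauss_moment m n @[n --> \oo] -->
  Num.sqrt pi / 2 * \prod_(i < m) (i%:R + 2^-1 : R).
Proof.
elim: m => [|m IH].
  rewrite big_ord0 mulr1.
  have := @ge0_cvgn_integral R mu _ gauss_fun_ge0 measurable_gauss_fun.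
  rewrite integral0y_gauss => /fine_cvgP[_] /=.
  apply: cvg_trans; apply: near_eq_cvg; near=> n; rewrite /gauss_moment.
  by under [in RHS]eq_Rintegral do rewrite muln0 expr0 mul1r.
rewrite big_ord_recr /=.
have -> : gauss_moment m.+1 = (fun n => (m%:R + 2^-1) * gauss_moment m n -
    2^-1 * (n%:R ^+ (2 * m + 1) * gauss_fun n%:R)).
  apply/funext => n; apply: (mulfI (x := 2)) => //; rewrite gauss_moment_recl.
  by rewrite natrD natrM; field.
rewrite (_ : _ * _ = (m%:R + 2^-1) *
    (Num.sqrt pi / 2 * \prod_(i < m) (i%:R + 2^-1 : R)) - 2^-1 * 0); last by ring.
apply: cvgB; first exact: cvgMl_tmp.
by apply: cvgMl_tmp; exact: cvg_gauss_boundary.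
Unshelve. all: by end_near. Qed.


Lemma continuous_gamma_integrand m :
  continuous (fun t : R => t ^+ m * Num.sqrt t * expR (- t)).
Proof.
move=> t; apply: cvgM; first apply: cvgM.
- exact: exprn_continuous.
- exact: sqrt_continuous.
- by apply: continuous_comp; [exact: opp_continuous|exact: continuous_expR].
Qed.

(** The substitution t = x^2, on the bounded interval [0, n^2]. *)
Lemma Rintegral_gamma_gauss m n :
  \int[mu]_(t in `[0, (n ^ 2)%:R]) (t ^+ m * Num.sqrt t * expR (- t)) =
  2 * gauss_moment m.+1 n.
Proof.
pose G (t : R) := t ^+ m * Num.sqrt t * expR (- t).
have cG : continuous G by exact: continuous_gamma_integrand.
have dsq (x : R) : is_derive x 1 (fun x : R => x ^+ 2) (2 * x).
  rewrite (_ : (fun x : R => x ^+ 2) = id ^+ 2); last by apply/funext => y; rewrite !fctE.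
  by apply: trigger_derive; rewrite /GRing.scale /= expr1; ring.
have dsqE : (fun x : R => x ^+ 2)^`()%classic = ( *%R 2).
  by apply/funext => x; rewrite derive1E; have [_ ->] := dsq x.
have csq : continuous (fun x : R => x ^+ 2) by exact: exprn_continuous.
have c2 : continuous ( *%R (2 : R)) by exact: mulrl_continuous.
have sub := @integration_by_substitution_increasing R (fun x : R => x ^+ 2) G 0 n%:R.
transitivity (fine (\int[mu]_(t in `[0%R, (n%:R ^+ 2)%R]) (G t)%:E)); first by rewrite -natrX.
move: sub; rewrite expr0n /= => -> //; first last.
- exact: continuous_subspaceT.
- split; first by move=> x _; have [] := dsq x.
  + exact/cvg_at_right_filter/csq.
  + exact/cvg_at_left_filter/csq.
- by rewrite dsqE; apply/cvg_ex; exists (2 * n%:R); apply/cvg_at_left_filter/c2.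
- by rewrite dsqE; apply/cvg_ex; exists (2 * 0); apply/cvg_at_right_filter/c2.
- by rewrite dsqE => x _; exact: c2.
- move=> x y; rewrite !in_itv /= => /andP[x0 _] /andP[y0 _] xy.
  by rewrite ltr_pXn2r.
rewrite -RintegralZl//; last first.
  by apply: continuous_itv_integrable => x _; exact: continuous_gauss_moment.
rewrite dsqE /Rintegral; congr fine; apply: eq_integral => x.
rewrite inE /= in_itv /= => /andP[x0 _].
rewrite /G /gauss_fun !fctE sqrtr_sqr ger0_norm//; congr EFin.
by rewrite -exprM mulnS exprD; ring.
Qed.

Lemma Gamma_half m : Gamma (m%:R + 2^-1 + 1) =
  Num.sqrt pi * \prod_(i < m.+1) (i%:R + 2^-1 : R).
Proof.
pose G (t : R) := t ^+ m * Num.sqrt t * expR (- t).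
transitivity (\int[mu]_(t in `[0, +oo[) (`|t| ^+ m * Num.sqrt t * expR (- t))).
  apply: eq_Rintegral => t; rewrite inE /= in_itv /= andbT => t0.
  rewrite addrK ger0_norm// powRD; last first.
    by apply/implyP; rewrite gt_eqF// ltr_wpDl.
  by rewrite powR_mulrn// powR12_sqrt.
rewrite /Rintegral.
have h0 (t : R) : 0 <= `|t| ^+ m * Num.sqrt t * expR (- t).
  by rewrite !mulr_ge0// ?exprn_ge0// ?expR_ge0.
have mh : measurable_fun setT (fun t : R => `|t| ^+ m * Num.sqrt t * expR (- t)).
  apply: continuous_measurable_fun => t; apply: cvgM; first apply: cvgM.
  - apply: (@continuous_comp _ _ _ (fun t : R => `|t|) (fun x : R => x ^+ m));
      [exact: (@norm_continuous _ R^o)|exact: exprn_continuous].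
  - exact: sqrt_continuous.
  - by apply: continuous_comp; [exact: opp_continuous|exact: continuous_expR].
have h1 := @ge0_cvgn_integral R mu _ h0 mh.
have sq : (fun n => (n ^ 2)%N) n @[n --> \oo] --> \oo.
  apply/cvgnyPge => A; near=> n.
  have nn : (n <= n ^ 2)%N by case: (n) => // k; rewrite expnS leq_pmulr// expn_gt0.
  by apply: leq_trans nn; near: n; exact: nbhs_infty_ge.
have h2 := cvg_comp _ _ sq h1.
have h3 : (2 * gauss_moment m.+1 n)%:E @[n --> \oo] -->
  (2 * (Num.sqrt pi / 2 * \prod_(i < m.+1) (i%:R + 2^-1)))%:E.
  by apply: cvg_EFin; [exact: nearW|apply: cvgMl_tmp; exact: cvg_gauss_moment].
rewrite (_ : \int[mu]_(x in `[0%R, +oo[) _ =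
   (2 * (Num.sqrt pi / 2 * \prod_(i < m.+1) (i%:R + 2^-1)))%:E)%E /=; first by field.
apply: (cvg_unique _ h2); first exact: ereal_hausdorff.
apply: cvg_trans h3; apply: near_eq_cvg; near=> n => /=.
rewrite -Rintegral_gamma_gauss /Rintegral fineK; last first.
  apply: integrable_fin_num => //.
  by apply: continuous_itv_integrable => x _; exact: continuous_gamma_integrand.
by apply: eq_integral => t; rewrite inE /= in_itv /= => /andP[t0 _]; rewrite ger0_norm.
Unshelve. all: by end_near. Qed.

End GammaHalf.

(** * Fourier transforms of Legendre polynomials *)

Section SphericalBessel.
Context {R : realType}.
Notation mu := (@lebesgue_measure R).
Implicit Types (p Q : {poly R}) (x y u : R) (n k j N : nat).

(** A bound for the polynomial on [-1, 1]. *)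
Definition polynorm p : R := \sum_(i < size p) `|p`_i|.

Lemma norm_horner_le p x : `|x| <= 1 -> `|p.[x]| <= polynorm p.
Proof.
move=> x1; rewrite horner_coef /polynorm (le_trans (ler_norm_sum _ _ _))//.
apply: ler_sum => i _; rewrite normrM normrX ler_piMr//.
by rewrite exprn_ile1.
Qed.

Lemma polynorm_ge0 p : 0 <= polynorm p.
Proof. exact: sumr_ge0. Qed.

(** Termwise integration of an entire series whose coefficients are dominated by
    those of the exponential: the partial sums are bounded by e^|x|. *)
Lemma Rintegral_power_series (e : nat -> R) (F : R -> R) Q x :
  (forall j, `|e j| <= j`!%:R^-1) -> continuous F ->
  (forall y, (fun N => \sum_(j < N) e j * y ^+ j) @ \oo --> F y) ->
  (fun N => \sum_(j < N) e j * x ^+ j * polyint (-1) 1 (Q * 'X^j)) @ \oo -->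
  \int[mu]_(u in `[-1, 1]) (F (x * u) * Q.[u]).
Proof.
move=> he cF hF.
pose q N : {poly R} := \sum_(j < N) (e j * x ^+ j) *: (Q * 'X^j).
have qE N u : (q N).[u] = (\sum_(j < N) e j * (x * u) ^+ j) * Q.[u].
  rewrite /q horner_sum mulr_suml; apply: eq_bigr => j _.
  by rewrite hornerZ hornerM hornerXn exprMn; ring.
have cFQ : continuous (fun u => F (x * u) * Q.[u]).
  move=> u; apply: cvgM; last exact: continuous_horner.
  by apply: (@continuous_comp _ _ _ ( *%R x) F); [exact: mulrl_continuous|exact: cF].
have iFQ : mu.-integrable `[-1, 1] (EFin \o (fun u => F (x * u) * Q.[u])).
  by apply: continuous_itv_integrable => u _; exact: cFQ.
have [|||||_ _] := @dominated_convergence _ _ _ mu `[-1, 1]%classic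
  (measurable_itv _) (fun N u => ((q N).[u])%:E)
  (fun u => (F (x * u) * Q.[u])%:E) (fun=> (expR `|x| * polynorm Q)%:E).
- move=> N; apply/measurable_EFinP/measurable_funTS.
  by apply: continuous_measurable_fun; exact: continuous_horner.
- by apply/measurable_EFinP/measurable_funTS; exact: continuous_measurable_fun.
- apply: aeW => u _; apply: cvg_EFin; first exact: nearW.
  rewrite [X in X @ _ --> _](_ : _ = fun N => (\sum_(j < N) e j * (x * u) ^+ j) * Q.[u]).
    exact: cvgMr_tmp.
  by apply/funext => N; rewrite /= qE.
- by apply: continuous_itv_integrable => u _; exact: cst_continuous.
- apply: aeW => u N /=; rewrite in_itv /= => u1.
  have {}u1 : `|u| <= 1 by rewrite ler_norml.
  rewrite lee_fin qE normrM ler_pM ?norm_horner_le// (le_trans (ler_norm_sum _ _ _))//.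
  apply: le_trans (_ : series (exp_coeff `|x|) N <= _); last first.
    apply: nondecreasing_cvgn_le; last exact: is_cvg_series_exp_coeff.
    apply/nondecreasing_seqP => m; rewrite /series /= big_nat_recr //= lerDl.
    by rewrite exp_coeff_ge0.
  rewrite /series /= big_mkord; apply: ler_sum => j _.
  rewrite normrM mulrC normrX normrM /exp_coeff /=.
  rewrite ler_pM ?exprn_ge0 ?mulr_ge0// lerXn2r ?nnegrE ?mulr_ge0//.
  by rewrite ler_piMr.
have ifin := integrable_fin_num _ iFQ.
rewrite -(fineK (ifin _))// => /fine_cvgP[_].
apply: cvg_trans; apply: near_eq_cvg; apply: nearW => N /=.
rewrite -[LHS]/(\int[mu]_(u in `[-1, 1]) (q N).[u]) Rintegral_horner; last by lra.
by rewrite /q linear_sum; apply: eq_bigr => j _; rewrite linearZ.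
Qed.

Definition re_ipow j : R := (~~ odd j)%:R * (-1) ^+ j./2.
Definition im_ipow j : R := (odd j)%:R * (-1) ^+ j.-1./2.

Lemma ipowE j : 'i%C ^+ j = (re_ipow j) +i* (im_ipow j) :> R[i].
Proof.
rewrite /re_ipow /im_ipow -[j in LHS]odd_double_half exprD -mul2n exprM.
rewrite (_ : ('i%C : R[i]) ^+ 2 = (-1)%:C); last by rewrite sqr_i rmorphN1.
rewrite -rmorphXn /=.
case oj: (odd j) => /=.
  rewrite expr1 mul0r mul1r (_ : j.-1./2 = j./2); last by move: oj; lia.
  by simpc.
by rewrite mul0r mul1r; simpc.
Qed.

Lemma re_ipow_addn_double n k : re_ipow (n + 2 * k) = (-1) ^+ k * re_ipow n.
Proof.
rewrite /re_ipow oddD mul2n odd_double addbF halfD odd_double andbF add0n doubleK exprD.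
by ring.
Qed.

Lemma im_ipow_addn_double n k : im_ipow (n + 2 * k) = (-1) ^+ k * im_ipow n.
Proof.
rewrite /im_ipow oddD mul2n odd_double addbF; case: n => [|n]; first by rewrite !mul0r mulr0.
by rewrite addSn /= halfD odd_double andbF add0n doubleK exprD; ring.
Qed.

Lemma sqr_ipow_sum n : re_ipow n * re_ipow n + im_ipow n * im_ipow n = 1.
Proof.
rewrite /re_ipow /im_ipow; set a := n./2; set b := n.-1./2.
have s m : (-1) ^+ m * (-1) ^+ m = 1 :> R by rewrite -exprD -signr_odd oddD addbb.
by case: (odd n) => /=; rewrite !(mul0r, mul1r) ?add0r ?addr0 s.
Qed.

(** The real number S_n(x) such that the Fourier integral of P_n at x is
    i^n S_n(x): multiply that integral by (-i)^n and take the real part. *)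
Definition spherical n x : R :=
  re_ipow n * \int[mu]_(u in `[-1, 1]) (cos (x * u) * (legendre n).[u]) +
  im_ipow n * \int[mu]_(u in `[-1, 1]) (sin (x * u) * (legendre n).[u]).

(** The n+2k-th term of the series of the Fourier integral, divided by i^n. *)
Definition spherical_coeff n x k : R :=
  (-1) ^+ k / (n + 2 * k)`!%:R * legendre_moment n (n + 2 * k) * x ^+ (n + 2 * k).

(** The moments of order below n, and those of the wrong parity, vanish; the
    surviving indices are n + 2k. *)
Lemma legendre_moment_series (e : nat -> R) n x K :
  (forall k, e (n + 2 * k)%N = (-1) ^+ k * e n) ->
  \sum_(j < n + 2 * K) e j / j`!%:R * x ^+ j * legendre_moment n j =
  e n * \sum_(k < K) spherical_coeff n x k.
Proof.
move=> he; elim: K => [|K IH].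
  rewrite big_ord0 mulr0 muln0 addn0 big1// => j _.
  by rewrite legendre_moment_small// mulr0.
rewrite mulnS addnCA add2n 2!big_ord_recr /= IH big_ord_recr /= [RHS]mulrDr -addrA. congr (_ + _).
rewrite (@legendre_moment_odd _ _ (n + 2 * K).+1) ?mulr0 ?addr0; last first.
  by rewrite addnS addnA addnn /= oddD odd_double mul2n odd_double.
by rewrite he /spherical_coeff; ring.
Qed.

Lemma cvg_sum_cos y : (fun N => \sum_(j < N) re_ipow j / j`!%:R * y ^+ j) @ \oo --> cos y.
Proof.
have := @is_cvg_series_cos_coeff R y.
rewrite -[lim _]/(limn (series (cos_coeff y))) => h.
have -> : cos y = limn (series (cos_coeff y)) by rewrite unlock.
apply: cvg_trans h; apply: near_eq_cvg; apply: nearW => N.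
rewrite /series /= big_mkord; apply: eq_bigr => j _.
by rewrite /cos_coeff /re_ipow /= -?exprnP mulrAC.
Qed.

Lemma cvg_sum_sin y : (fun N => \sum_(j < N) im_ipow j / j`!%:R * y ^+ j) @ \oo --> sin y.
Proof.
have := @is_cvg_series_sin_coeff R y.
rewrite -[lim _]/(limn (series (sin_coeff y))) => h.
have -> : sin y = limn (series (sin_coeff y)) by rewrite unlock.
apply: cvg_trans h; apply: near_eq_cvg; apply: nearW => N.
by rewrite /series /= big_mkord; apply: eq_bigr => j _; rewrite /sin_coeff /im_ipow /= mulrAC.
Qed.

(** The full series converges to the integral; its partial sums at the indices
    n + 2K are those of the spherical series. *)
Lemma cvg_legendre_cos n x :
  (fun K => re_ipow n * \sum_(k < K) spherical_coeff n x k) @ \oo -->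
  \int[mu]_(u in `[-1, 1]) (cos (x * u) * (legendre n).[u]).
Proof.
have := @Rintegral_power_series (fun j => re_ipow j / j`!%:R) cos (legendre n) x.
have e1 j : `|re_ipow j / j`!%:R| <= j`!%:R^-1.
  rewrite /re_ipow !normrM normfV normr_nat normrX normrN1 expr1n mulr1 normr_nat.
  by rewrite ler_piMl ?invr_ge0//; case: (odd j).
move=> /(_ e1 (@continuous_cos R) cvg_sum_cos).
have sq : (fun K => n + 2 * K)%N K @[K --> \oo] --> \oo.
  apply/cvgnyPge => A; near=> K; apply: leq_trans (_ : K <= _)%N; last by lia.
  by near: K; exact: nbhs_infty_ge.
move=> /(cvg_comp _ _ sq); apply: cvg_trans; apply: near_eq_cvg; apply: nearW => K.
by rewrite /= -legendre_moment_series//; exact: re_ipow_addn_double.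
Unshelve. all: by end_near. Qed.

Lemma cvg_legendre_sin n x :
  (fun K => im_ipow n * \sum_(k < K) spherical_coeff n x k) @ \oo -->
  \int[mu]_(u in `[-1, 1]) (sin (x * u) * (legendre n).[u]).
Proof.
have := @Rintegral_power_series (fun j => im_ipow j / j`!%:R) sin (legendre n) x.
have e1 j : `|im_ipow j / j`!%:R| <= j`!%:R^-1.
  rewrite /im_ipow !normrM normfV normr_nat normrX normrN1 expr1n mulr1 normr_nat.
  by rewrite ler_piMl ?invr_ge0//; case: (odd j).
move=> /(_ e1 (@continuous_sin R) cvg_sum_sin).
have sq : (fun K => n + 2 * K)%N K @[K --> \oo] --> \oo.
  apply/cvgnyPge => A; near=> K; apply: leq_trans (_ : K <= _)%N; last by lia.
  by near: K; exact: nbhs_infty_ge.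
move=> /(cvg_comp _ _ sq); apply: cvg_trans; apply: near_eq_cvg; apply: nearW => K.
by rewrite /= -legendre_moment_series//; exact: im_ipow_addn_double.
Unshelve. all: by end_near. Qed.

(** One of Re(i^n), Im(i^n) is zero and the other is 1 or -1; adding the cosine
    and sine series with these weights undoes the factor i^n. *)
Lemma cvg_spherical n x :
  (fun K => \sum_(k < K) spherical_coeff n x k) @ \oo --> spherical n x.
Proof.
have -> : (fun K => \sum_(k < K) spherical_coeff n x k) = fun K =>
  re_ipow n * (re_ipow n * \sum_(k < K) spherical_coeff n x k) +
  im_ipow n * (im_ipow n * \sum_(k < K) spherical_coeff n x k).
  apply/funext => K; rewrite [X in _ = X + _]mulrA.
  by rewrite [X in _ = _ + X]mulrA -mulrDl sqr_ipow_sum mul1r.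
by apply: cvgD; apply: cvgMl_tmp; [exact: cvg_legendre_cos|exact: cvg_legendre_sin].
Qed.

Lemma Rintegral_cos_legendre n x :
  \int[mu]_(u in `[-1, 1]) (cos (x * u) * (legendre n).[u]) = re_ipow n * spherical n x.
Proof.
apply: (cvg_unique _ (@cvg_legendre_cos n x)); first exact: Rhausdorff.
by apply: cvgMl_tmp; exact: cvg_spherical.
Qed.

Lemma Rintegral_sin_legendre n x :
  \int[mu]_(u in `[-1, 1]) (sin (x * u) * (legendre n).[u]) = im_ipow n * spherical n x.
Proof.
apply: (cvg_unique _ (@cvg_legendre_sin n x)); first exact: Rhausdorff.
by apply: cvgMl_tmp; exact: cvg_spherical.
Qed.

Lemma sphericalN n x : spherical n (- x) = (-1) ^+ n * spherical n x.
Proof.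
rewrite /spherical.
under eq_Rintegral do rewrite mulNr cosN.
under [X in _ + _ * X]eq_Rintegral do rewrite mulNr sinN mulNr.
have -> : \int[mu]_(u in `[-1, 1]) - (sin (x * u) * (legendre n).[u]) =
   - \int[mu]_(u in `[-1, 1]) (sin (x * u) * (legendre n).[u]).
  rewrite -[RHS]mulN1r -RintegralZl//; first by apply: eq_Rintegral => u _; rewrite mulN1r.
  apply: continuous_itv_integrable => u _; apply: cvgM; last exact: continuous_horner.
  by apply: (@continuous_comp _ _ _ ( *%R x) sin); [exact: mulrl_continuous|exact: continuous_sin].
rewrite -signr_odd /re_ipow /im_ipow; case: (odd n) => /=; ring.
Qed.

End SphericalBessel.

(** * Bessel functions of half-integer order *)

Section BesselHalf.
Context {R : realType}.
Implicit Types (x y : R) (n k : nat).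

Lemma fact_double k :
  (2 * k)`!%:R = 4 ^+ k * k`!%:R * \prod_(i < k) (i%:R + 2^-1) :> R.
Proof.
elim: k => [|k IH]; first by rewrite big_ord0 expr0 !mulr1.
have e1 : (2 * k).+1%:R = 2 * k%:R + 1 :> R by rewrite -natr1 natrM.
have e2 : (2 * k).+2%:R = 2 * k%:R + 1 + 1 :> R by rewrite -natr1 e1.
rewrite mulnS add2n !factS !natrM IH big_ord_recr /= exprS e1 e2 -[k.+1%:R]natr1.
by field.
Qed.

(** Comparison of the two power series term by term.  With the values of Gamma
    and of the moments inserted, both sides agree up to
    (2k)! = 4^k k! (1/2)(3/2)...(k - 1/2). *)
Lemma besselJ_half (nu : R) n y : nu - 2^-1 = n%:R -> 0 <= y ->
  besselJ nu y * Num.sqrt y = y / Num.sqrt (2 * pi) * spherical n y.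
Proof.
move=> hn y0; have nuE : nu = n%:R + 2^-1 by rewrite -hn subrK.
have [->|yn0] := eqVneq y 0; first by rewrite sqrtr0 mulr0 !mul0r.
have {yn0}y0 : 0 < y by rewrite lt_def yn0.
have sy : Num.sqrt y != 0 by rewrite gt_eqF// sqrtr_gt0.
have s2 : Num.sqrt 2 != 0 :> R by rewrite gt_eqF// sqrtr_gt0.
have sp : Num.sqrt pi != 0 :> R by rewrite gt_eqF// sqrtr_gt0 pi_gt0.
have syy : Num.sqrt y * Num.sqrt y = y by rewrite -expr2 sqr_sqrtr// ltW.
suff : series (fun k : nat => (-1) ^+ k / (k`!%:R * Gamma (k%:R + nu + 1)) *
    (y / 2) `^ (2 * k%:R + nu)) @ \oo -->
    y / Num.sqrt (2 * pi) / Num.sqrt y * spherical n y.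
  by move=> /cvg_lim => h; rewrite /besselJ h// mulrAC divfK.
have -> : series (fun k : nat => (-1) ^+ k / (k`!%:R * Gamma (k%:R + nu + 1)) *
    (y / 2) `^ (2 * k%:R + nu)) = fun K =>
    y / Num.sqrt (2 * pi) / Num.sqrt y * \sum_(k < K) spherical_coeff n y k.
  apply/funext => K; rewrite /series /= big_mkord mulr_sumr; apply: eq_bigr => k _.
  rewrite nuE addrA -natrD Gamma_half addrA -natrM -natrD powRD; last first.
    by apply/implyP; rewrite gt_eqF// ltr_wpDl.
  rewrite powR_mulrn ?divr_ge0// ?ltW// powR12_sqrt ?divr_ge0// ?ltW//.
  rewrite sqrtrM ?ltW// sqrtrV// sqrtrM// /spherical_coeff legendre_moment_even.
  rewrite -addnS big_split_ord /=.
  set A := \prod_(i < k) _; set B := \prod_(i < n.+1) _; set B' := \prod_(i < n.+1) _.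
  have BE : B' = B.
    by apply: eq_bigr => i _; rewrite natrD.
  have f0 m : m`!%:R != 0 :> R by rewrite pnatr_eq0 -lt0n fact_gt0.
  have A0 : A != 0.
    by apply/prodf_neq0 => i _; rewrite gt_eqF// ltr_wpDl ?invr_gt0.
  have B0 : B != 0.
    by apply/prodf_neq0 => i _; rewrite gt_eqF// ltr_wpDl ?invr_gt0.
  rewrite BE fact_double -/A [(n + 2 * k)%N]addnC exprMn exprVn exprD exprM.
  (* the y in the numerator only: y / sqrt y must reduce to sqrt y *)
  rewrite -[X in _ = X / _ / _ * _]syy.
  have -> : (2 : R) ^+ (2 * k + n) = 4 ^+ k * 2 ^+ n by rewrite exprD exprM -natrX.
  move: (f0 (2 * k + n)%N) (f0 k) => g1 g2.
  have t0 : (4 : R) ^+ k != 0 by rewrite expf_neq0.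
  have t'0 : (2 : R) ^+ n != 0 by rewrite expf_neq0.
  move: ((-1) ^+ k) ((y ^+ 2) ^+ k) (y ^+ n) => u1 u2 u3.
  move: (Num.sqrt y) (Num.sqrt 2) (Num.sqrt pi) A B sy s2 sp A0 B0 {B' BE syy}.
  move: (4 ^+ k) (2 ^+ n) ((2 * k + n)`!%:R) (k`!%:R) t0 t'0 g1 g2.
  move=> t t' g g' t0 t'0 g1 g2 a b c A B a0 b0 c0 A0 B0.
  by field; rewrite a0 b0 c0 A0 B0 g1 g2 t0 t'0.
by apply: cvgMl_tmp; exact: cvg_spherical.
Qed.

End BesselHalf.

(** * Fubini's theorem for bounded kernels *)

Section FubiniBounded.
Context {R : realType}.
Notation mu := (@lebesgue_measure R).
Local Notation TR := (measurableTypeR R).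
Variables (D1 D2 : set TR) (mD1 : measurable D1) (mD2 : measurable D2).
Hypothesis D2fin : (mu D2 < +oo)%E.
Variables (k : TR -> R) (ik : mu.-integrable D1 (EFin \o k)).
Variables (w : TR * TR -> R) (M : R).
Hypothesis mw : measurable_fun (D1 `*` D2) w.
Hypothesis wM : forall x y, D1 x -> D2 y -> `|w (x, y)| <= M.

Let k' := k \_ D1.
Let w' := w \_ (D1 `*` D2).
Let F (z : TR * TR) : \bar R := (k' z.1 * w' z)%:E.
Let mD12 : measurable (D1 `*` D2). Proof. exact: measurableX. Qed.

Let mw' : measurable_fun setT w'.
Proof. exact: (measurable_restrictT w mD12).1. Qed.

Let ik' : mu.-integrable setT (EFin \o k').
Proof. by have := (integrable_mkcond _ mD1).1 ik; rewrite restrict_EFin. Qed.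

Let mk' : measurable_fun setT k'.
Proof. by apply/measurable_EFinP; exact: measurable_int ik'. Qed.

Let w'le z : `|w' z| <= `|M| * \1_D2 z.2.
Proof.
rewrite /w' patchE; case: ifPn => [|_]; last by rewrite normr0 mulr_ge0.
rewrite inE => -[/= d1 d2]; rewrite indicE mem_set// mulr1.
by rewrite (le_trans _ (ler_norm M))//; case: z d1 d2 => /= *; exact: wM.
Qed.

Let mF : measurable_fun setT F.
Proof.
apply/measurable_EFinP; apply: measurable_funM; last exact: mw'.
by apply: measurableT_comp; [exact: mk'|exact: measurable_fst].
Qed.

Let iF : (mu \x mu)%E.-integrable setT F.
Proof.
have ink : mu.-integrable setT (fun x => `|k' x|%:E) by exact: integrable_norm.
apply/(integrable12ltyP _ _ _).2 => //.
apply: (@le_lt_trans _ _ (\int[mu]_x (`|k' x|%:E * (`|M| * fine (mu D2))%:E))%E); last first.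
  rewrite integralZr// lte_mul_pinfty//; first exact: integral_ge0.
    exact: integrable_fin_num.
  by rewrite ltry.
have mF' : measurable_fun setT (abse \o F) by exact: measurableT_comp.
apply: ge0_le_integral => //.
- by move=> x _; exact: integral_ge0.
- apply: (measurable_fun_fubini_tonelli_F (abse \o F)); first exact: mF'.
  by move=> z; exact: abse_ge0.
- by apply: emeasurable_funM => //; case/integrableP : ink.
- move=> x _.
  rewrite EFinM fineK; last by rewrite ge0_fin_numE.
  have -> : mu D2 = (\int[mu]_y (\1_D2 y)%:E)%E by rewrite integral_indic// setIT.
  rewrite -ge0_integralZl//; last first.
    by apply/measurable_EFinP; exact: measurable_indic.
  rewrite -ge0_integralZl//; last first.
    by apply/measurable_EFinP/measurable_funM => //; exact: measurable_indic.
  apply: ge0_le_integral => //.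
  + by apply: measurableT_comp => //; apply: measurableT_comp => //; exact: pair1_measurable.
  + apply/measurable_EFinP/measurable_funM => //.
    by apply/measurable_funM => //; exact: measurable_indic.
  + by move=> y _; rewrite lee_fin normrM ler_wpM2l.
Qed.

Let wsec x : D1 x -> measurable_fun D2 (fun y => w (x, y)).
Proof.
move=> d1; apply: (measurable_restrictT (fun y => w (x, y)) mD2).2.
have -> : (fun y => w (x, y)) \_ D2 = fun y => w' (x, y).
  apply/funext => y; rewrite /w' !patchE in_setX /=.
  by rewrite (mem_set d1).
by apply: measurableT_comp => //; exact: pair1_measurable.
Qed.

Let F1E x : (\int[mu]_y F (x, y))%E =
  (if x \in D1 then k x * \int[mu]_(y in D2) w (x, y) else 0)%:E.
Proof.
case: ifPn => [|xD]; last first.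
  by rewrite integral0_eq// => y _; rewrite /F /k' patchE (negbTE xD) mul0r.
rewrite inE => d1.
have iw : mu.-integrable D2 (EFin \o (fun y => w (x, y))).
  apply: measurable_bounded_integrable => //; first exact: wsec.
  exists M; split; first exact: num_real.
  by move=> t Mt y /= d2; rewrite (le_trans (wM d1 d2))// ltW.
rewrite /Rintegral EFinM fineK; last exact: integrable_fin_num.
rewrite -integralZl// [RHS]integral_mkcond; apply: eq_integral => y _.
rewrite /F /k' /w' !patchE /= (mem_set d1) in_setX /= (mem_set d1) /=.
by case: ifPn => // _; rewrite mulr0.
Qed.

Lemma integrable_kernel_section y : D2 y ->
  mu.-integrable D1 (EFin \o (fun x => k x * w (x, y))).
Proof.
move=> d2; apply: (@le_integrable _ _ _ mu D1 mD1 _ (EFin \o (fun x => k x * M))).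
- apply/measurable_EFinP/measurable_funM.
    by case/integrableP : ik => /measurable_EFinP.
  apply: (measurable_restrictT (fun x => w (x, y)) mD1).2.
  have -> : (fun x => w (x, y)) \_ D1 = fun x => w' (x, y).
    by apply/funext => x; rewrite /w' !patchE in_setX /= (mem_set d2) andbT.
  by apply: measurableT_comp => //; exact: pair2_measurable.
- move=> x d1 /=; rewrite lee_fin !normrM ler_wpM2l// (le_trans (wM d1 d2))//.
  exact: ler_norm.
- exact: (integrableZr mD1 M ik).
Qed.

Let F2E y : (\int[mu]_x F (x, y))%E =
  (if y \in D2 then \int[mu]_(x in D1) (k x * w (x, y)) else 0)%:E.
Proof.
case: ifPn => [|yD]; last first.
  rewrite integral0_eq// => x _; rewrite /F /w' patchE in_setX /= (negbTE yD) andbF.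
  by rewrite mulr0.
rewrite inE => d2.
rewrite /Rintegral fineK; last by apply: integrable_fin_num => //; exact: integrable_kernel_section.
rewrite [RHS]integral_mkcond; apply: eq_integral => x _.
rewrite /F /k' /w' !patchE /= in_setX /= (mem_set d2) andbT.
by case: ifPn => // _; rewrite mul0r.
Qed.

(** A kernel k(x) w(x, y) with k integrable and w bounded on a set of finite
    measure is integrable on the product.  Extending k and w by zero reduces
    the statement to the whole plane. *)
Lemma Rintegral_fubini_bounded :
  \int[mu]_(x in D1) (k x * \int[mu]_(y in D2) w (x, y)) =
  \int[mu]_(y in D2) \int[mu]_(x in D1) (k x * w (x, y)).
Proof.
rewrite /Rintegral; congr fine.
rewrite integral_mkcond [RHS]integral_mkcond.
transitivity (\int[mu]_x \int[mu]_y F (x, y))%E.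
  by apply: eq_integral => x _; rewrite F1E patchE; case: ifPn.
transitivity (\int[mu]_y \int[mu]_x F (x, y))%E; first exact: Fubini iF.
by apply: eq_integral => y _; rewrite F2E patchE; case: ifPn.
Qed.

Lemma measurable_kernel_integral :
  measurable_fun D2 (fun y => \int[mu]_(x in D1) (k x * w (x, y))).
Proof.
apply: (measurable_restrictT (fun y => \int[mu]_(x in D1) (k x * w (x, y))) mD2).2.
apply/measurable_EFinP.
have := measurable_fubini_G iF; rewrite /fubini_G.
apply: eq_measurable_fun => y _; rewrite [LHS]F2E /= patchE.
by case: ifPn.
Qed.

Lemma kernel_integral_le y : D2 y ->
  `|\int[mu]_(x in D1) (k x * w (x, y))| <= M * \int[mu]_(x in D1) `|k x|.
Proof.
move=> d2; apply: le_trans; first exact/le_normr_Rintegral/integrable_kernel_section.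
rewrite -RintegralZl//; last exact: integrable_norm.
apply: le_Rintegral => //.
- exact/integrable_norm/integrable_kernel_section.
- have := @integrableZl _ _ _ mu D1 mD1 M (EFin \o (fun x => `|k x|)).
  by apply; exact: integrable_norm.
- by move=> x d1; rewrite normrM mulrC ler_wpM2r// wM.
Qed.

Lemma integrable_kernel_outer :
  mu.-integrable D1 (EFin \o (fun x => k x * \int[mu]_(y in D2) w (x, y))).
Proof.
apply/(integrable_mkcond _ mD1).
apply: eq_integrable (integrable_fubini_F iF) => // x _.
by rewrite [LHS]F1E patchE; case: ifPn.
Qed.

Lemma integrable_kernel_integral :
  mu.-integrable D2 (EFin \o (fun y => \int[mu]_(x in D1) (k x * w (x, y)))).
Proof.
apply: measurable_bounded_integrable => //; first exact: measurable_kernel_integral.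
exists (M * \int[mu]_(x in D1) `|k x|); split; first exact: num_real.
by move=> t Mt y /= d2; rewrite (le_trans (kernel_integral_le d2))// ltW.
Qed.

End FubiniBounded.

(** * Complex-valued integrals *)

Section ComplexIntegral.
Context {R : realType}.
Notation mu := (@lebesgue_measure R).
Local Notation TR := (measurableTypeR R).
Implicit Types (D : set TR) (f g : R -> R[i]) (z : R[i]).

Definition cintegrable D f :=
  mu.-integrable D (EFin \o (fun x => complex.Re (f x))) /\
  mu.-integrable D (EFin \o (fun x => complex.Im (f x))).

Lemma complex_eq z1 z2 :
  complex.Re z1 = complex.Re z2 -> complex.Im z1 = complex.Im z2 -> z1 = z2 :> R[i].
Proof. by case: z1 z2 => [a b] [c d] /= -> ->. Qed.

Lemma cReM z1 z2 : complex.Re (z1 * z2) =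
  complex.Re z1 * complex.Re z2 - complex.Im z1 * complex.Im z2 :> R.
Proof. by case: z1 z2 => [a b] [c d]. Qed.

Lemma cImM z1 z2 : complex.Im (z1 * z2) =
  complex.Re z1 * complex.Im z2 + complex.Im z1 * complex.Re z2 :> R.
Proof. by case: z1 z2 => [a b] [c d] /=. Qed.

Lemma cReMC z (a : R) : complex.Re (z * a%:C) = complex.Re z * a.
Proof. by rewrite cReM mulr0 subr0. Qed.

Lemma cImMC z (a : R) : complex.Im (z * a%:C) = complex.Im z * a.
Proof. by rewrite cImM mulr0 add0r. Qed.

Lemma cReCM (a : R) z : complex.Re (a%:C * z) = a * complex.Re z.
Proof. by rewrite cReM mul0r subr0. Qed.

Lemma cImCM (a : R) z : complex.Im (a%:C * z) = a * complex.Im z.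
Proof. by rewrite cImM mul0r addr0. Qed.

Lemma eq_cintegral D f g : (forall x, D x -> f x = g x) ->
  cintegral D f = cintegral D g.
Proof.
move=> fg; congr (_ +i* _); apply: eq_Rintegral => x; rewrite inE => Dx; by rewrite fg.
Qed.

Lemma cintegralZ D z f : measurable D -> cintegrable D f ->
  cintegral D (fun x => z * f x) = z * cintegral D f.
Proof.
move=> mD [i1 i2].
have iz (a : R) (h : R -> R) : mu.-integrable D (EFin \o h) ->
    mu.-integrable D (EFin \o (fun x => a * h x)) by exact: integrableZl.
apply: complex_eq.
  rewrite cReM /=; under eq_Rintegral do rewrite cReM.
  by rewrite RintegralB ?RintegralZl//; exact: iz.
rewrite cImM /=; under eq_Rintegral do rewrite cImM.
by rewrite RintegralD ?RintegralZl//; exact: iz.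
Qed.

Lemma cintegrableZ D z f : measurable D -> cintegrable D f ->
  cintegrable D (fun x => z * f x).
Proof.
move=> mD [i1 i2].
have iz (a : R) (h : R -> R) : mu.-integrable D (EFin \o h) ->
    mu.-integrable D (EFin \o (fun x => a * h x)) by exact: integrableZl.
split.
  under eq_fun do rewrite cReM.
  by have := integrableB mD (iz (complex.Re z) _ i1) (iz (complex.Im z) _ i2).
under eq_fun do rewrite cImM.
by have := integrableD mD (iz (complex.Re z) _ i2) (iz (complex.Im z) _ i1).
Qed.

(** The kernels that may be integrated against an integrable function in either
    order. *)
Definition cbounded_kernel (D1 D2 : set TR) (w : R -> R -> R[i]) :=
  [/\ measurable_fun (D1 `*` D2) (fun z : TR * TR => complex.Re (w z.1 z.2)),
      measurable_fun (D1 `*` D2) (fun z : TR * TR => complex.Im (w z.1 z.2)) &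
      exists M, forall x y, D1 x -> D2 y ->
        `|complex.Re (w x y)| <= M /\ `|complex.Im (w x y)| <= M].

Section CFubini.
Variables (D1 D2 : set TR) (mD1 : measurable D1) (mD2 : measurable D2).
Hypothesis D2fin : (mu D2 < +oo)%E.
Variables (k : R -> R[i]) (ik : cintegrable D1 k).
Variables (w : R -> R -> R[i]) (bw : cbounded_kernel D1 D2 w).

Lemma cintegral_fubini :
  cintegral D1 (fun x => k x * cintegral D2 (w x)) =
  cintegral D2 (fun y => cintegral D1 (fun x => k x * w x y)).
Proof.
have [mr mi [M hM]] := bw; have [kr ki] := ik.
have hr x y : D1 x -> D2 y -> `|complex.Re (w x y)| <= M by move=> a /(hM _ _ a)[].
have hi x y : D1 x -> D2 y -> `|complex.Im (w x y)| <= M by move=> a /(hM _ _ a)[].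
pose wr (z : TR * TR) := complex.Re (w z.1 z.2).
pose wi (z : TR * TR) := complex.Im (w z.1 z.2).
pose kR x := complex.Re (k x); pose kI x := complex.Im (k x).
have sec y : D2 y ->
   [/\ mu.-integrable D1 (EFin \o (fun x => kR x * wr (x, y))),
    mu.-integrable D1 (EFin \o (fun x => kI x * wr (x, y))),
    mu.-integrable D1 (EFin \o (fun x => kR x * wi (x, y))) &
    mu.-integrable D1 (EFin \o (fun x => kI x * wi (x, y)))].
  move=> d2; split.
  - exact: (@integrable_kernel_section _ D1 D2 mD1 mD2 _ kr wr M).
  - exact: (@integrable_kernel_section _ D1 D2 mD1 mD2 _ ki wr M).
  - exact: (@integrable_kernel_section _ D1 D2 mD1 mD2 _ kr wi M).
  - exact: (@integrable_kernel_section _ D1 D2 mD1 mD2 _ ki wi M).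
apply: complex_eq => /=.
  under eq_Rintegral do rewrite cReM /=.
  rewrite RintegralB//; first last.
  - exact: (@integrable_kernel_outer _ D1 D2 mD1 mD2 D2fin kI ki wi M).
  - exact: (@integrable_kernel_outer _ D1 D2 mD1 mD2 D2fin kR kr wr M).
  rewrite (@Rintegral_fubini_bounded _ D1 D2 mD1 mD2 D2fin kR kr wr M)//.
  rewrite (@Rintegral_fubini_bounded _ D1 D2 mD1 mD2 D2fin kI ki wi M)//.
  rewrite -RintegralB//; first last.
  - exact: (@integrable_kernel_integral _ D1 D2 mD1 mD2 D2fin kI ki wi M).
  - exact: (@integrable_kernel_integral _ D1 D2 mD1 mD2 D2fin kR kr wr M).
  apply: eq_Rintegral => y; rewrite inE => /sec[h1 h2 h3 h4].
  by rewrite -RintegralB//; apply: eq_Rintegral => x _; rewrite cReM.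
under eq_Rintegral do rewrite cImM /=.
rewrite RintegralD//; first last.
- exact: (@integrable_kernel_outer _ D1 D2 mD1 mD2 D2fin kI ki wr M).
- exact: (@integrable_kernel_outer _ D1 D2 mD1 mD2 D2fin kR kr wi M).
rewrite (@Rintegral_fubini_bounded _ D1 D2 mD1 mD2 D2fin kR kr wi M)//.
rewrite (@Rintegral_fubini_bounded _ D1 D2 mD1 mD2 D2fin kI ki wr M)//.
rewrite -RintegralD//; first last.
- exact: (@integrable_kernel_integral _ D1 D2 mD1 mD2 D2fin kI ki wr M).
- exact: (@integrable_kernel_integral _ D1 D2 mD1 mD2 D2fin kR kr wi M).
apply: eq_Rintegral => y; rewrite inE => /sec[h1 h2 h3 h4].
by rewrite -RintegralD//; apply: eq_Rintegral => x _; rewrite cImM.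
Qed.

Lemma cmeasurable_kernel_integral :
  cmeasurable D2 (fun y => cintegral D1 (fun x => k x * w x y)).
Proof.
have [mr mi [M hM]] := bw; have [kr ki] := ik.
have hr x y : D1 x -> D2 y -> `|complex.Re (w x y)| <= M by move=> a /(hM _ _ a)[].
have hi x y : D1 x -> D2 y -> `|complex.Im (w x y)| <= M by move=> a /(hM _ _ a)[].
pose wr (z : TR * TR) := complex.Re (w z.1 z.2).
pose wi (z : TR * TR) := complex.Im (w z.1 z.2).
pose kR x := complex.Re (k x); pose kI x := complex.Im (k x).
have m1 := @measurable_kernel_integral _ D1 D2 mD1 mD2 D2fin kR kr wr M mr hr.
have m2 := @measurable_kernel_integral _ D1 D2 mD1 mD2 D2fin kI ki wi M mi hi.
have m3 := @measurable_kernel_integral _ D1 D2 mD1 mD2 D2fin kR kr wi M mi hi.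
have m4 := @measurable_kernel_integral _ D1 D2 mD1 mD2 D2fin kI ki wr M mr hr.
split.
  apply: (eq_measurable_fun _ _ (measurable_funB m1 m2)) => y; rewrite inE => d2 /=.
  rewrite -RintegralB//; first by apply: eq_Rintegral => x _; rewrite cReM.
    exact: (@integrable_kernel_section _ D1 D2 mD1 mD2 _ kr wr M).
  exact: (@integrable_kernel_section _ D1 D2 mD1 mD2 _ ki wi M).
apply: (eq_measurable_fun _ _ (measurable_funD m3 m4)) => y; rewrite inE => d2 /=.
rewrite -RintegralD//; first by apply: eq_Rintegral => x _; rewrite cImM.
  exact: (@integrable_kernel_section _ D1 D2 mD1 mD2 _ kr wi M).
exact: (@integrable_kernel_section _ D1 D2 mD1 mD2 _ ki wr M).
Qed.

End CFubini.

End ComplexIntegral.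

(** * Integrability and dilations *)

Section IntegralHelpers.
Context {R : realType}.
Notation mu := (@lebesgue_measure R).
Local Notation TR := (measurableTypeR R).
Implicit Types (D : set TR) (f : R -> R[i]) (g : R -> R).

Lemma lebesgue_itv_finite (a b : R) (x y : bool) :
  (mu [set` Interval (BSide x a) (BSide y b)] < +oo)%E.
Proof.
have h := @lebesgue_measure_itv R (Interval (BSide x a) (BSide y b)).
apply: (eq_ind_r (fun z => (z < +oo)%E) _ h).
by rewrite /=; case: ifP => _; rewrite ?ltry.
Qed.

Lemma integrableM_bounded D g (h : R -> R) M : measurable D ->
  measurable_fun D h -> (forall x, D x -> `|h x| <= M) ->
  mu.-integrable D (EFin \o g) -> mu.-integrable D (EFin \o (fun x => g x * h x)).
Proof.
move=> mD mh hM ig.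
have bh : [bounded h x | x in D].
  by exists M; split; [exact: num_real|move=> t Mt x /= Dx; rewrite (le_trans (hM x Dx))// ltW].
apply: eq_integrable (integrableMr mD mh bh ig) => // x _.
by rewrite /= -EFinM mulrC.
Qed.

Lemma cintegrableM_bounded D f (h : R -> R) M : measurable D ->
  measurable_fun D h -> (forall x, D x -> `|h x| <= M) ->
  cintegrable D f -> cintegrable D (fun x => f x * (h x)%:C).
Proof.
move=> mD mh hM [i1 i2]; split.
  by under eq_fun do rewrite cReMC; exact: integrableM_bounded hM i1.
by under eq_fun do rewrite cImMC; exact: integrableM_bounded hM i2.
Qed.

Lemma cintegrableM D f h M : measurable D -> cmeasurable D h ->
  (forall x, D x -> `|complex.Re (h x)| <= M /\ `|complex.Im (h x)| <= M) ->
  cintegrable D f -> cintegrable D (fun x => f x * h x).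
Proof.
move=> mD [m1 m2] hM [i1 i2].
have hr x : D x -> `|complex.Re (h x)| <= M by move=> /hM[].
have hi x : D x -> `|complex.Im (h x)| <= M by move=> /hM[].
split.
  under eq_fun do rewrite cReM.
  by have := integrableB mD (integrableM_bounded mD m1 hr i1) (integrableM_bounded mD m2 hi i2).
under eq_fun do rewrite cImM.
by have := integrableD mD (integrableM_bounded mD m2 hi i1) (integrableM_bounded mD m1 hr i2).
Qed.

(** |a| <= 1 + a^2 + b^2, and constants are integrable on a set of finite
    measure. *)
Lemma inL2_cintegrable D D' f : measurable D -> measurable D' -> D' `<=` D ->
  (mu D' < +oo)%E -> inL2 D f -> cintegrable D' f.
Proof.
move=> mD mD' sub fin [[m1 m2] L2].
have ms : measurable_fun D (fun x => sqnorm (f x)).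
  by apply: measurable_funD; apply: measurable_funX.
have iS : mu.-integrable D' (EFin \o (fun x => 1 + sqnorm (f x))).
  have i1 : mu.-integrable D' (EFin \o (cst 1 : TR -> R)).
    apply: measurable_bounded_integrable => //; exists 1; split; first exact: num_real.
    by move=> t t1 x _ /=; rewrite normr1 ltW.
  have i2 : mu.-integrable D' (EFin \o (fun x => sqnorm (f x))).
    apply: (integrableS mD) => //; apply/integrableP; split; first exact/measurable_EFinP.
    under eq_integral do rewrite /= ger0_norm ?addr_ge0 ?sqr_ge0//.
    exact: L2.
  exact: (integrableD mD' i1 i2).
have key (a b : R) : `|a| <= 1 + (a ^+ 2 + b ^+ 2).
  rewrite ler_norml; nra.
split; apply: (le_integrable mD' _ _ iS).
- by apply/measurable_EFinP; exact: measurable_funS m1.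
- move=> x _; rewrite /= lee_fin; apply: le_trans (key _ _) _; exact: ler_norm.
- by apply/measurable_EFinP; exact: measurable_funS m2.
- move=> x _; rewrite /= lee_fin /sqnorm; apply: le_trans (key _ (complex.Re (f x))) _.
  by rewrite [X in 1 + X]addrC; exact: ler_norm.
Qed.

(** The substitution y = a u; the cut-off confines y to [-a, a], which lies in
    [-1, 1]. *)
Lemma Rintegral_dilation (G : R -> R) (a : R) : continuous G -> 0 < a <= 1 ->
  \int[mu]_(y in `[-1, 1]) (if `|y| <= a then G (y / a) else 0) =
  a * \int[mu]_(u in `[-1, 1]) G u.
Proof.
move=> cG /andP[a0 a1].
have aN0 : a != 0 by rewrite gt_eqF.
have cm (b : R) : continuous (fun y : R => y * b) by exact: mulrr_continuous.
have cGa : continuous (fun y : R => G (y / a)).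
  by move=> y; apply: (@continuous_comp _ _ _ (fun y : R => y / a) G); [exact: cm|exact: cG].
transitivity (\int[mu]_(y in `[- a, a]) G (y / a)).
  rewrite Rintegral_mkcond [RHS]Rintegral_mkcond; apply: eq_Rintegral => y _.
  rewrite !patchE; case: ifPn => y1.
    case: ifPn => ya; first by rewrite mem_set//= in_itv /= -ler_norml.
    rewrite memNset//= in_itv /= -ler_norml; exact/negP.
  rewrite memNset//= in_itv /= -ler_norml => ya; move: y1 => /negP; apply.
  by rewrite inE /= in_itv /= -ler_norml (le_trans ya).
have d (y : R) : is_derive y 1 (fun y => y / a) a^-1.
  rewrite (_ : (fun y : R => y / a) = a^-1 \*: id); last first.
    by apply/funext => z /=; rewrite /GRing.scale /= mulrC.
  by apply: trigger_derive; rewrite /GRing.scale /= mulr1.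
have dE : (fun y : R => y / a)^`()%classic = cst a^-1.
  by apply/funext => y; rewrite derive1E; have [_ ->] := d y.
have := @integration_by_substitution_increasing R (fun y => y / a) G (- a) a.
rewrite mulNr divff// => sub.
have {}sub : \int[mu]_(u in `[-1, 1]) G u = a^-1 * \int[mu]_(y in `[- a, a]) G (y / a).
  rewrite -RintegralZl//; last by apply: continuous_itv_integrable => y _; exact: cGa.
  rewrite [LHS]/Rintegral sub//.
  - by rewrite dE /Rintegral; congr fine; apply: eq_integral => y _; rewrite !fctE mulrC.
  - by lra.
  - by move=> x y _ _ xy; rewrite ltr_pM2r// invr_gt0.
  - by rewrite dE => x _; exact: cst_continuous.
  - by rewrite dE; exact: is_cvg_cst.
  - by rewrite dE; exact: is_cvg_cst.
  - split; first by move=> x _; have [] := d x.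
    + exact/cvg_at_right_filter/cm.
    + exact/cvg_at_left_filter/cm.
  - exact: continuous_subspaceT.
by rewrite sub mulVKf.
Qed.

(** A pointwise limit of polynomials. *)
Lemma measurable_spherical n : measurable_fun setT (spherical n : TR -> R).
Proof.
apply: (@measurable_fun_cvg _ TR R setT
  (fun K x => \sum_(k < K) spherical_coeff n x k)).
  move=> K; apply: measurable_sum => k.
  by apply: measurable_funM => //; exact: measurable_funX.
by move=> x _; exact: cvg_spherical.
Qed.

Lemma spherical_bounded n x : `|spherical n x : R| <= 4 * polynorm (legendre n).
Proof.
have b (F : R -> R) : continuous F -> (forall x, `|F x| <= 1) ->
    `|\int[mu]_(u in `[-1, 1]) (F (x * u) * (legendre n).[u])| <= 2 * polynorm (legendre n).
  move=> cF F1.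
  have iF : mu.-integrable `[-1, 1] (EFin \o (fun u => F (x * u) * (legendre n).[u])).
    apply: continuous_itv_integrable => u _; apply: cvgM; last exact: continuous_horner.
    by apply: (@continuous_comp _ _ _ ( *%R x) F); [exact: mulrl_continuous|exact: cF].
  apply: le_trans (le_normr_Rintegral _ iF) _ => //.
  apply: (@le_trans _ _ (\int[mu]_(u in `[-1, 1]) polynorm (legendre n))).
    apply: le_Rintegral => //; first exact: integrable_norm.
      by apply: continuous_itv_integrable => u _; exact: cst_continuous.
    move=> u /=; rewrite in_itv /= -ler_norml => u1.
    by rewrite normrM -[leRHS]mul1r ler_pM// norm_horner_le.
  rewrite Rintegral_cst// [X in fine X](_ : _ = 2%:E); first by rewrite mulrC.
  apply: etrans (lebesgue_measure_itv _) _; rewrite /= lte_fin ifT; last by lra.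
  by rewrite -EFinB; congr EFin; ring.
have ip (c : R) : `|c| <= 1 -> forall a B : R, `|a| <= B -> `|c * a| <= B.
  by move=> c1 a B aB; rewrite normrM -[leRHS]mul1r ler_pM.
have s1 m : `|(-1) ^+ m : R| = 1 by rewrite normrX normrN1 expr1n.
rewrite /spherical (le_trans (ler_normD _ _))//.
rewrite (_ : 4 * _ = 2 * polynorm (legendre n) + 2 * polynorm (legendre n)); last by ring.
apply: lerD; apply: ip.
- by rewrite normrM s1 mulr1 normr_nat; case: (odd n).
- by apply: b => [|y]; [exact: continuous_cos|rewrite ler_norml cos_geN1 cos_le1].
- by rewrite normrM s1 mulr1 normr_nat; case: (odd n).
- by apply: b => [|y]; [exact: continuous_sin|rewrite ler_norml sin_geN1 sin_le1].
Qed.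

End IntegralHelpers.

(** * The Fourier preimage of the Hankel transform *)

Section Profile.
Context {R : realType}.
Notation mu := (@lebesgue_measure R).
Local Notation TR := (measurableTypeR R).
Implicit Types (D : set TR) (f F : R -> R[i]) (g : R -> R) (n : nat).
Variables (n : nat) (sigma : R).
Hypothesis sigma0 : 0 < sigma.
Local Notation P := (@legendre R n).

(** The kernel of [profile]; the cut-off makes every integral in s run over the
    fixed interval ]0, sigma]. *)
Definition legendre_cut (s y : R) : R :=
  if sigma * `|y| <= s then P.[sigma * y / s] else 0.

(** For F = C f this is the function whose F_c-transform is h_{r,nu}. *)
Definition profile F (y : R) : R[i] :=
  cintegral `]0, sigma] (fun s => F s * (legendre_cut s y)%:C).

(** The value at t of the Fourier transform of [profile], after the exchange of
    integrals; up to a constant, h(t)/t. *)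
Definition spherical_transform F (t : R) : R[i] :=
  cintegral `]0, sigma]
    (fun s => F s * ((s / sigma)%:C * 'i%C ^+ n * (spherical n (t * s))%:C)).

Lemma legendre_cut_le s y : 0 < s -> `|legendre_cut s y| <= polynorm P.
Proof.
move=> s0; rewrite /legendre_cut; case: ifPn => h; last by rewrite normr0 polynorm_ge0.
apply: norm_horner_le; rewrite normrM normfV normrM (gtr0_norm sigma0) (gtr0_norm s0).
by rewrite ler_pdivrMr// mul1r.
Qed.

(** On positive reals the inverse is the power -1, and powers are
    measurable. *)
Lemma measurable_inv_pos : measurable_fun (`]0, sigma] : set TR) (fun s : TR => s^-1 : R).
Proof.
apply: (eq_measurable_fun (fun s => s `^ (-1))).
  by move=> s; rewrite inE /= in_itv /= => /andP[s0 _]; rewrite powR_inv1// ltW.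
by apply: measurable_funTS; exact: measurable_powR.
Qed.

Lemma measurable_legendre_cut D : measurable D ->
  measurable_fun ((`]0, sigma] : set TR) `*` D)
    (fun z : TR * TR => legendre_cut z.1 z.2).
Proof.
move=> mD.
have mI : measurable (`]0, sigma]%classic : set TR) by exact: measurable_itv.
have mX : measurable ((`]0, sigma] : set TR) `*` D) by exact: measurableX.
pose b (z : TR * TR) : bool := sigma * `|z.2| <= z.1.
have mb : measurable_fun setT b.
  apply: measurable_fun_ler; last exact: measurable_fst.
  apply: measurable_funM => //; apply: measurableT_comp => //; exact: measurable_snd.
pose q (z : TR * TR) : R := P.[sigma * z.2 * z.1 `^ (-1)].
have mq : measurable_fun setT q.
  apply: (@measurableT_comp _ _ _ _ _ _ (horner P)).
    by apply: continuous_measurable_fun; exact: continuous_horner.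
  apply: measurable_funM.
    by apply: measurable_funM => //; exact: measurable_snd.
  apply: (@measurableT_comp _ _ _ _ _ _ (@powR R ^~ (-1))); first exact: measurable_powR.
  exact: measurable_fst.
apply: (eq_measurable_fun (fun z => if b z then q z else 0)).
  move=> [s y]; rewrite inE /= => -[/=]; rewrite in_itv /= => /andP[s0 _] _.
  by rewrite /legendre_cut /b /q /= powR_inv1// ltW.
by apply: measurable_funTS; exact: measurable_fun_ifT.
Qed.

Lemma cut_section_measurable y :
  measurable_fun (`]0, sigma] : set TR) (fun s : TR => legendre_cut s y).
Proof.
have m := measurable_legendre_cut (measurable_set1 y).
have mI : measurable (`]0, sigma]%classic : set TR) by exact: measurable_itv.
have mX : measurable ((`]0, sigma] : set TR) `*` [set y]) by exact: measurableX.
apply: (measurable_restrictT (fun s : TR => legendre_cut s y) mI).2.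
have -> : (fun s : TR => legendre_cut s y) \_ `]0, sigma] = fun s : TR =>
    ((fun z : TR * TR => legendre_cut z.1 z.2) \_ (`]0, sigma] `*` [set y])) (s, y).
  apply/funext => s; rewrite !patchE in_setX /=.
  by rewrite [y \in _]mem_set// andbT.
apply: measurableT_comp; last exact: pair2_measurable.
exact: (measurable_restrictT _ mX).1.
Qed.

Lemma cintegrable_cut F y : cintegrable `]0, sigma] F ->
  cintegrable `]0, sigma] (fun s => F s * (legendre_cut s y)%:C).
Proof.
move=> iF; apply: (@cintegrableM_bounded _ _ _ _ (polynorm P)) => //.
  exact: cut_section_measurable.
by move=> s; rewrite /= in_itv /= => /andP[s0 _]; exact: legendre_cut_le.
Qed.

Lemma profile_components F y :
  profile F y = (\int[mu]_(s in `]0, sigma]) (complex.Re (F s) * legendre_cut s y)) +i*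
    (\int[mu]_(s in `]0, sigma]) (complex.Im (F s) * legendre_cut s y)).
Proof.
by congr (_ +i* _); apply: eq_Rintegral => s _; rewrite (cReMC, cImMC).
Qed.

Lemma profile_bounded F : cintegrable `]0, sigma] F ->
  exists M, forall y, `|complex.Re (profile F y)| <= M /\ `|complex.Im (profile F y)| <= M.
Proof.
move=> [i1 i2].
exists (Num.max (polynorm P * \int[mu]_(s in `]0, sigma]) `|complex.Re (F s)|)
  (polynorm P * \int[mu]_(s in `]0, sigma]) `|complex.Im (F s)|)) => y.
rewrite profile_components /= !le_max; split; apply/orP; [left|right].
  apply: (@kernel_integral_le _ `]0, sigma]%classic setT _ _ _ i1
    (fun z : TR * TR => legendre_cut z.1 z.2)) => //.
    exact: measurable_legendre_cut.
  by move=> s t /=; rewrite in_itv /= => /andP[s0 _] _; exact: legendre_cut_le.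
apply: (@kernel_integral_le _ `]0, sigma]%classic setT _ _ _ i2
    (fun z : TR * TR => legendre_cut z.1 z.2)) => //.
  exact: measurable_legendre_cut.
by move=> s t /=; rewrite in_itv /= => /andP[s0 _] _; exact: legendre_cut_le.
Qed.

Lemma measurable_profile D F : measurable D -> (mu D < +oo)%E ->
  cintegrable `]0, sigma] F -> cmeasurable D (profile F).
Proof.
move=> mD Dfin [i1 i2]; split.
  have := @measurable_kernel_integral _ `]0, sigma]%classic D (measurable_itv _) mD Dfin
    _ i1 (fun z : TR * TR => legendre_cut z.1 z.2) (polynorm P) (measurable_legendre_cut mD).
  under [in X in _ -> X]eq_fun do rewrite profile_components.
  apply => s t /=; rewrite in_itv /= => /andP[s0 _] _; exact: legendre_cut_le.
have := @measurable_kernel_integral _ `]0, sigma]%classic D (measurable_itv _) mD Dfin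
    _ i2 (fun z : TR * TR => legendre_cut z.1 z.2) (polynorm P) (measurable_legendre_cut mD).
under [in X in _ -> X]eq_fun do rewrite profile_components.
by apply => s t /=; rewrite in_itv /= => /andP[s0 _] _; exact: legendre_cut_le.
Qed.

(** The substitution u = sigma y / s turns the phase r sigma x y into r x s u,
    and the cut-off into [-1, 1]. *)
Lemma cintegral_cut_cis (r x s : R) : 0 < s <= sigma ->
  cintegral `[-1, 1] (fun y => (legendre_cut s y)%:C * cis (r * sigma * x * y)) =
  (s / sigma)%:C * 'i%C ^+ n * (spherical n (r * x * s))%:C.
Proof.
move=> /andP[s0 ss].
have a1 : 0 < s / sigma <= 1 by rewrite divr_gt0//= ler_pdivrMr// mul1r.
have key (G : R -> R) : continuous G ->
    \int[mu]_(y in `[-1, 1]) (legendre_cut s y * G (r * sigma * x * y)) =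
    s / sigma * \int[mu]_(u in `[-1, 1]) (G (r * x * s * u) * P.[u]).
  move=> cG; rewrite -Rintegral_dilation//; last first.
    move=> u; apply: cvgM; last exact: continuous_horner.
    by apply: (@continuous_comp _ _ _ ( *%R (r * x * s)) G); [exact: mulrl_continuous|exact: cG].
  apply: eq_Rintegral => y _; rewrite /legendre_cut ler_pdivlMr// [`|y| * _]mulrC.
  case: ifPn => _; last by rewrite mul0r.
  rewrite mulrC; congr (G _ * P.[_]); field; rewrite ?(gt_eqF s0) ?(gt_eqF sigma0)//.
transitivity ((s / sigma * (re_ipow n * spherical n (r * x * s))) +i*
   (s / sigma * (im_ipow n * spherical n (r * x * s))) : R[i]).
  congr (_ +i* _).
    rewrite -Rintegral_cos_legendre -key; last exact: continuous_cos.
    by apply: eq_Rintegral => y _; rewrite cReCM.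
  rewrite -Rintegral_sin_legendre -key; last exact: continuous_sin.
  by apply: eq_Rintegral => y _; rewrite cImCM.
apply: complex_eq; rewrite /= ipowE.
  by rewrite cReMC cReM /= mul0r subr0 mulrA.
by rewrite cImMC cImM /= mul0r addr0 mulrA.
Qed.

Lemma measurable_cos_sin_line (a : R) : measurable_fun setT (fun y : TR => cos (a * y)) /\
  measurable_fun setT (fun y : TR => sin (a * y)).
Proof.
by split; apply: continuous_measurable_fun => y;
  apply: (@continuous_comp _ _ _ ( *%R a)); rewrite /continuous_at;
  (exact: mulrl_continuous || exact: continuous_cos || exact: continuous_sin).
Qed.

(** Fubini, then the inner integral in y is explicit. *)
Lemma Fc_profile (r x : R) F : cintegrable `]0, sigma] F ->
  Fc (r * sigma) (profile F) x = spherical_transform F (r * x).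
Proof.
move=> iF.
pose w (s y : R) := (legendre_cut s y)%:C * cis (r * sigma * x * y) : R[i].
have wR s y : complex.Re (w s y) = legendre_cut s y * cos (r * sigma * x * y) by exact: cReCM.
have wI s y : complex.Im (w s y) = legendre_cut s y * sin (r * sigma * x * y) by exact: cImCM.
transitivity (cintegral `]0, sigma] (fun s => F s * cintegral `[-1, 1] (w s))); last first.
  apply: eq_cintegral => s; rewrite /= in_itv /= => s0.
  by rewrite /w cintegral_cut_cis.
rewrite cintegral_fubini//; first last.
- have m := measurable_legendre_cut (measurable_itv `[-1, 1]).
  have [mc msn] := measurable_cos_sin_line (r * sigma * x).
  split.
  + apply: (eq_measurable_fun (fun z : TR * TR =>
      legendre_cut z.1 z.2 * cos (r * sigma * x * z.2))); first by move=> z _; rewrite wR.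
    apply: measurable_funM => //; apply: measurable_funTS.
    by apply: (measurableT_comp mc); exact: measurable_snd.
  + apply: (eq_measurable_fun (fun z : TR * TR =>
      legendre_cut z.1 z.2 * sin (r * sigma * x * z.2))); first by move=> z _; rewrite wI.
    apply: measurable_funM => //; apply: measurable_funTS.
    by apply: (measurableT_comp msn); exact: measurable_snd.
  + exists (polynorm P) => s y sI _.
    have /andP[s0 _] : 0 < s <= sigma by move: sI; rewrite /= in_itv.
    have h := legendre_cut_le y s0.
    rewrite wR wI !normrM; split; rewrite -[leRHS]mulr1 ler_pM//.
      by rewrite ler_norml cos_geN1 cos_le1.
    by rewrite ler_norml sin_geN1 sin_le1.
- exact: lebesgue_itv_finite.
apply: eq_cintegral => y _; rewrite -cintegralZ//; last exact: cintegrable_cut.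
by apply: eq_cintegral => s _; rewrite /w; ring.
Qed.

Lemma cintegrable_spherical_transform F t : cintegrable `]0, sigma] F ->
  cintegrable `]0, sigma]
    (fun s => F s * ((s / sigma)%:C * 'i%C ^+ n * (spherical n (t * s))%:C)).
Proof.
move=> iF.
have m : cintegrable `]0, sigma] (fun s => F s * (s / sigma * spherical n (t * s))%:C).
  apply: (@cintegrableM_bounded _ _ _ _ (4 * polynorm P)) => //.
    apply: measurable_funM; first exact: mulrr_measurable.
    apply: measurable_funTS; apply: (measurableT_comp (measurable_spherical n)).
    exact: mulrl_measurable.
  move=> s; rewrite /= in_itv /= => /andP[s0 s1]; rewrite normrM -[leRHS]mul1r.
  rewrite ler_pM ?spherical_bounded// ger0_norm; last by rewrite divr_ge0 ?(ltW s0) ?(ltW sigma0).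
  by rewrite ler_pdivrMr// mul1r.
have := cintegrableZ ('i%C ^+ n) (measurable_itv _) m.
rewrite (_ : (fun s => 'i%C ^+ n * (F s * (s / sigma * spherical n (t * s))%:C)) =
  fun s => F s * ((s / sigma)%:C * 'i%C ^+ n * (spherical n (t * s))%:C))//.
by apply/funext => s; rewrite rmorphM /=; ring.
Qed.

Lemma spherical_transformN F t : cintegrable `]0, sigma] F ->
  spherical_transform F (- t) = (-1) ^+ n * spherical_transform F t.
Proof.
move=> iF; rewrite /spherical_transform -cintegralZ//; last exact: cintegrable_spherical_transform.
apply: eq_cintegral => s _; rewrite mulNr sphericalN !rmorphM rmorphXn rmorphN1 /=.
by ring.
Qed.

End Profile.

(** * Null sets and limits in L^2 *)

Section AlmostEverywhere.
Context {R : realType}.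
Notation mu := (@lebesgue_measure R).
Local Notation TR := (measurableTypeR R).
Implicit Types (D : set TR) (f g phi : R -> R[i]) (sigma : R).

Lemma measurable_dilation sigma : measurable_fun setT (fun t : TR => t / sigma : TR).
Proof. exact: mulrr_measurable. Qed.

(** The pushforward of the Lebesgue measure by t -> t / sigma, divided by sigma,
    agrees with the Lebesgue measure on intervals. *)
Lemma lebesgue_measure_dilation sigma (A : set TR) : 0 < sigma -> measurable A ->
  mu [set t | A (t / sigma)] = (sigma%:E * mu A)%E.
Proof.
move=> s0 mA.
have si : 0 <= sigma^-1 by rewrite invr_ge0 ltW.
pose p : {nonneg R} := NngNum si.
(* nu0 still takes the measurability of the dilation as an argument *)
pose nu0 : {measure set TR -> \bar R} := mscale p (pushforward mu (fun t : TR => t / sigma : TR)).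
pose nu := nu0 (measurable_dilation sigma).
have h : forall X, ocitv X -> mu X = nu X.
  move=> X [[a b] /= _ <-].
  rewrite /nu /nu0 /mscale /pushforward /=.
  rewrite -[pushforward _ _ _]/(mu ((fun t : TR => t / sigma) @^-1` `]a, b]%classic)).
  rewrite (_ : _ @^-1` _ = `](sigma * a), (sigma * b)]%classic); last first.
    apply/seteqP; split => t /=; rewrite !in_itv /= ltr_pdivlMr// ler_pdivrMr//.
      by rewrite ![_ * sigma]mulrC.
    by rewrite ![sigma * _]mulrC.
  rewrite !lebesgue_measure_itv /= !lte_fin ltr_pM2l//.
  case: ifP => _; last by rewrite mule0.
  by rewrite -!EFinB -EFinM; congr EFin; field; rewrite gt_eqF.
rewrite (lebesgue_measure_unique h mA) /nu /nu0 /mscale /pushforward /=.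
by rewrite muleA -EFinM divff ?gt_eqF// mul1e.
Qed.

Lemma negligible_dilation sigma (A : set TR) : 0 < sigma ->
  mu.-negligible A -> mu.-negligible [set t | A (t / sigma)].
Proof.
move=> s0 [B [mB B0 AB]]; exists [set t | B (t / sigma)]; split.
- by have := @measurable_dilation sigma measurableT B mB; rewrite setTI.
- by apply: etrans (lebesgue_measure_dilation s0 mB) _; rewrite B0 mule0.
- by move=> t /AB.
Qed.

Lemma ae_eq_cintegral D f g : measurable D -> cmeasurable D f -> cmeasurable D g ->
  {ae mu, forall x, D x -> f x = g x} -> cintegral D f = cintegral D g.
Proof.
move=> mD [f1 f2] [g1 g2] fg.
congr (_ +i* _); rewrite /Rintegral; congr fine; apply: ae_eq_integral => //;
  try exact/measurable_EFinP; by apply: filterS fg => x h /h ->.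
Qed.

Lemma cmeasurableM D f g : cmeasurable D f -> cmeasurable D g ->
  cmeasurable D (fun x => f x * g x).
Proof.
move=> [f1 f2] [g1 g2]; split.
  under eq_fun do rewrite cReM.
  by apply: measurable_funB; exact: measurable_funM.
under eq_fun do rewrite cImM.
by apply: measurable_funD; exact: measurable_funM.
Qed.

Lemma cmeasurable_real D (g : R -> R) : measurable_fun D (g : TR -> R) ->
  cmeasurable D (fun x => (g x)%:C).
Proof. by move=> mg; split. Qed.

Lemma ae_neq (a : R) : {ae mu, forall x : R, x != a}.
Proof.
have h : mu.-negligible ([set a] : set TR).
  by apply/negligibleP => //; exact: lebesgue_measure_set1.
by apply: negligibleS h => x /= /negP; rewrite negbK => /eqP.
Qed.

Lemma Rintegral_ae_support sigma (u : R -> R) : 0 < sigma ->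
  measurable_fun (`[0, +oo[ : set TR) (u : TR -> R) ->
  {ae mu, forall s, sigma < s -> u s = 0} ->
  \int[mu]_(s in `[0, +oo[) u s = \int[mu]_(s in `]0, sigma]) u s.
Proof.
move=> s0 mf u0.
rewrite (_ : `]0, sigma]%classic = `[0, +oo[%classic `&` `]0, sigma]%classic); last first.
  apply/seteqP; split => x /=; rewrite !in_itv /= ?andbT; last by case.
  by move=> /andP[x0 x1]; rewrite x0 x1 ltW.
rewrite /Rintegral integral_mkcondr; congr fine.
have mI : measurable (`]0, sigma]%classic : set TR) by exact: measurable_itv.
apply: ae_eq_integral => //; first exact/measurable_EFinP.
  apply/(measurable_restrict (EFin \o u) mI (measurable_itv `[0, +oo[)).
  by apply: measurable_funS (measurable_itv `[0, +oo[) _ _ => //; exact/measurable_EFinP.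
have aeF := ae_filter_ringOfSetsType mu.
apply: (@filterS _ _ aeF _ _ _ (@filterI _ _ aeF _ _ u0 (ae_neq 0))) =>
  x [{}u0 x0]; rewrite /= in_itv /= andbT => x1.
rewrite patchE; case: ifPn => //; rewrite notin_setE /= in_itv /= lt_def x0 x1 /=.
by move=> /negP; rewrite -ltNge => /u0 ->.
Qed.

(** |f - g|^2 <= 2 |u - f|^2 + 2 |u - g|^2, so the integral of |f - g|^2 is zero. *)
Lemma cvgL2_unique D (u : nat -> R -> R[i]) f g : measurable D ->
  (forall N, cmeasurable D (u N)) -> cmeasurable D f -> cmeasurable D g ->
  cvgL2 D u f -> cvgL2 D u g -> {ae mu, forall x, D x -> f x = g x}.
Proof.
move=> mD mu_ mf mg uf ug.
have msq h k : cmeasurable D h -> cmeasurable D k ->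
    measurable_fun D (fun x : TR => (sqnorm (h x - k x))%:E).
  move=> [h1 h2] [k1 k2]; apply/measurable_EFinP.
  by apply: measurable_funD; apply: measurable_funX; rewrite /=;
    under eq_fun do rewrite raddfB /=; exact: measurable_funB.
have sq0 (z : R[i]) : 0 <= sqnorm z by rewrite addr_ge0 ?sqr_ge0.
have le N : (\int[mu]_(x in D) (sqnorm (f x - g x))%:E <=
   2%:E * \int[mu]_(x in D) (sqnorm (u N x - f x))%:E +
   2%:E * \int[mu]_(x in D) (sqnorm (u N x - g x))%:E)%E.
  rewrite -!ge0_integralZl//; last 4 first.
  - exact: msq.
  - by move=> x _; rewrite lee_fin.
  - exact: msq.
  - by move=> x _; rewrite lee_fin.
  rewrite -ge0_integralD//; last 4 first.
  - by move=> x _; rewrite mule_ge0 ?lee_fin.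
  - by apply: emeasurable_funM => //; exact: msq.
  - by move=> x _; rewrite mule_ge0 ?lee_fin.
  - by apply: emeasurable_funM => //; exact: msq.
  apply: ge0_le_integral => //.
  - by move=> x _; rewrite lee_fin.
  - exact: msq.
  - by apply: emeasurable_funD; apply: emeasurable_funM => //; exact: msq.
  - move=> x _; rewrite -!EFinM -EFinD lee_fin /sqnorm.
    have key (a b c : R) : (a - b) ^+ 2 <= 2 * (c - a) ^+ 2 + 2 * (c - b) ^+ 2.
      by rewrite -subr_ge0 (_ : _ - _ = (2 * c - a - b) ^+ 2) ?sqr_ge0//; ring.
    case: (f x) (g x) (u N x) => [a a'] [b b'] [c c'] /=.
    by have := key a b c; have := key a' b' c'; lra.
have l0 : (\int[mu]_(x in D) (sqnorm (f x - g x))%:E <= 0)%E.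
  have c0 : ((2%:E * \int[mu]_(x in D) (sqnorm (u N x - f x))%:E +
   2%:E * \int[mu]_(x in D) (sqnorm (u N x - g x))%:E)%E @[N --> \oo] --> (0 : \bar R)).
    rewrite [X in _ --> X](_ : _ = (2%:E * 0%:E + 2%:E * 0%:E)%E); last by rewrite !mule0 adde0.
    apply: cvgeD; first by rewrite !mule0.
      exact: cvgeZl.
    exact: cvgeZl.
  by apply: (cvge_ge _ c0); apply: nearW => N; exact: le.
have /(ae_eq_integral_abs _ mD (msq _ _ mf mg)) :
    (\int[mu]_(x in D) `|(sqnorm (f x - g x))%:E| = 0)%E.
  apply/eqP; rewrite eq_le; apply/andP; split; last exact: integral_ge0.
  apply: le_trans l0; rewrite le_eqVlt; apply/orP; left; apply/eqP.
  by apply: eq_integral => x _; rewrite gee0_abs// lee_fin.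
apply: filterS => x h /h [] /eqP; rewrite paddr_eq0 ?sqr_ge0// !expf_eq0 /= => /andP[/eqP a /eqP b].
by apply/eqP; rewrite -subr_eq0; apply/eqP/complex_eq.
Qed.

End AlmostEverywhere.

(** * The range of F_c *)

Section HankelRange.
Context {R : realType}.
Notation mu := (@lebesgue_measure R).
Local Notation TR := (measurableTypeR R).
Implicit Types (D : set TR) (f F phi : R -> R[i]).

(** The constant C: with it, i^n C / sigma = 1 / sqrt(2 pi). *)
Definition hankel_const (n : nat) (sigma : R) : R[i] :=
  (- 'i%C) ^+ n * (sigma / Num.sqrt (2 * pi))%:C.

Lemma hankel_spherical_transform (nu : R) n sigma f t : nu - 2^-1 = n%:R ->
  0 < sigma -> 0 < t -> inL2 `[0, +oo[ f ->
  {ae mu, forall s : R, sigma < s -> f s = 0} ->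
  hankel nu f t = t%:C * spherical_transform n sigma (fun s => hankel_const n sigma * f s) t.
Proof.
move=> hn sg0 t0 f2 supp.
have [[m1 m2] _] := f2.
have sp : Num.sqrt (2 * pi) != 0 :> R by rewrite gt_eqF// sqrtr_gt0 mulr_gt0// pi_gt0.
have iF : cintegrable `]0, sigma] f.
  apply: inL2_cintegrable f2 => //; last exact: lebesgue_itv_finite.
  by move=> x /=; rewrite !in_itv /= andbT => /andP[/ltW].
pose g s : R := t * s / Num.sqrt (2 * pi) * spherical n (t * s).
have mg : measurable_fun setT (g : TR -> R).
  apply: measurable_funM.
    by apply: measurable_funM => //; exact: mulrl_measurable.
  apply: (measurableT_comp (measurable_spherical n)); exact: mulrl_measurable.
rewrite /spherical_transform -cintegralZ//; last first.
  by apply: cintegrable_spherical_transform => //; exact: cintegrableZ.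
transitivity (cintegral `]0, sigma] (fun s => f s * (g s)%:C)); last first.
  apply: eq_cintegral => s _; rewrite /g /hankel_const.
  have i1 : (- 'i%C) ^+ n * 'i%C ^+ n = 1 :> R[i].
    by rewrite -exprMn mulNr -expr2 sqr_i opprK expr1n.
  have e : (t * s / Num.sqrt (2 * pi) * spherical n (t * s))%:C =
     t%:C * (sigma / Num.sqrt (2 * pi))%:C * (s / sigma)%:C * (spherical n (t * s))%:C :> R[i].
    by rewrite -!rmorphM /=; congr (_%:C); field; rewrite sp gt_eqF.
  rewrite e -[LHS]mul1r -[X in X * _ = _]i1; ring.
rewrite /hankel; transitivity (cintegral `[0, +oo[ (fun s => f s * (g s)%:C)).
  apply: eq_cintegral => s; rewrite /= in_itv /= andbT => s0.
  have ts0 : 0 <= t * s by rewrite mulr_ge0// ltW.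
  by rewrite (besselJ_half hn ts0).
have mgI : measurable_fun (`[0, +oo[ : set TR) (g : TR -> R) by exact: measurable_funTS.
have [mm1 mm2] : cmeasurable `[0, +oo[ (fun s => f s * (g s)%:C).
  by apply: cmeasurableM => //; exact: cmeasurable_real.
have aeF := ae_filter_ringOfSetsType mu.
by congr (_ +i* _); apply: Rintegral_ae_support => //;
  apply: (@filterS _ _ aeF _ _ _ supp) => s h /h ->; rewrite mul0r.
Qed.

(** For x < 0 the factor -(-1)^n in h_{r,nu} is what the parity (-1)^n of S_n and
    the sign of 1/(rx) require.  At x = 0 the formula for h_{r,nu} is a limit,
    and a single point does not matter for the series or almost everywhere. *)
Lemma h_ext_profile (nu : R) n r sigma f x : nu - 2^-1 = n%:R ->
  0 < r -> 0 < sigma -> inL2 `[0, +oo[ f ->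
  {ae mu, forall s : R, sigma < s -> f s = 0} -> x != 0 ->
  h_ext n r (hankel nu f) x =
  Fc (r * sigma) (profile n sigma (fun s => hankel_const n sigma * f s)) x.
Proof.
move=> hn r0 sg0 f2 supp x0.
have iF : cintegrable `]0, sigma] f.
  apply: inL2_cintegrable f2 => //; last exact: lebesgue_itv_finite.
  by move=> y /=; rewrite !in_itv /= andbT => /andP[/ltW].
have iCF : cintegrable `]0, sigma] (fun s => hankel_const n sigma * f s) by exact: cintegrableZ.
have key t : 0 < t -> (t^-1)%:C * hankel nu f t =
    spherical_transform n sigma (fun s => hankel_const n sigma * f s) t.
  move=> t0; rewrite (hankel_spherical_transform hn sg0 t0 f2 supp) mulrA -rmorphM /=.
  by rewrite mulVf ?gt_eqF// mul1r.
rewrite Fc_profile// /h_ext (negbTE x0); case: ifPn => xp.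
  by rewrite key// mulr_gt0.
have xn : 0 < - (r * x).
  by rewrite -mulrN mulr_gt0// oppr_gt0 lt_neqAle x0 leNgt.
have := key _ xn; rewrite spherical_transformN// => h.
rewrite -[RHS]mul1r -[X in _ = X * _](_ : (-1) ^+ n * (-1) ^+ n = 1); last first.
  by rewrite -exprD -signr_odd oddD addbb.
rewrite -[RHS]mulrA -h invrN rmorphN /=; ring.
Qed.

Lemma inL2_profile n sigma F : 0 < sigma -> cintegrable `]0, sigma] F ->
  inL2 `[-1, 1] (profile n sigma F).
Proof.
move=> sg0 iF; have [m1 m2] :=
  measurable_profile n sg0 (measurable_itv `[-1, 1]) (lebesgue_itv_finite _ _ _ _) iF.
split => //.
have [M hM] := profile_bounded n sg0 iF.
have iS : mu.-integrable `[-1, 1] (EFin \o (fun y => sqnorm (profile n sigma F y))).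
  apply: measurable_bounded_integrable => //; first exact: lebesgue_itv_finite.
    by apply: measurable_funD; exact: measurable_funX.
  exists (M ^+ 2 + M ^+ 2); split; first exact: num_real.
  move=> t Mt y _ /=; apply: le_trans (ltW Mt).
  have [h1 h2] := hM y; rewrite ger0_norm ?addr_ge0 ?sqr_ge0//.
  rewrite lerD// -[X in X <= _]real_normK ?num_real// lerXn2r ?nnegrE//.
    exact: le_trans (normr_ge0 _) h1.
  exact: le_trans (normr_ge0 _) h2.
by case/integrableP: iS => _; under eq_integral do rewrite /= ger0_norm ?addr_ge0 ?sqr_ge0//.
Qed.

Lemma cmeasurable_snd D D' phi : measurable D -> measurable D' -> cmeasurable D' phi ->
  measurable_fun (D `*` D') (fun z : TR * TR => complex.Re (phi z.2)) /\
  measurable_fun (D `*` D') (fun z : TR * TR => complex.Im (phi z.2)).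
Proof.
move=> mD mD' [m1 m2].
have s2 : measurable_fun (D `*` D') (snd : TR * TR -> TR).
  by apply: measurable_funTS; exact: measurable_snd.
have sub : snd @` (D `*` D') `<=` D' by move=> _ [z [_ h] <-].
split.
  exact: (@measurable_comp _ _ _ _ _ _ D' (fun y => complex.Re (phi y)) _ snd mD' sub m1 s2).
exact: (@measurable_comp _ _ _ _ _ _ D' (fun y => complex.Im (phi y)) _ snd mD' sub m2 s2).
Qed.

Lemma measurable_cos_sin_prod c : measurable_fun setT (fun z : TR * TR => cos (c * z.1 * z.2)) /\
  measurable_fun setT (fun z : TR * TR => sin (c * z.1 * z.2)).
Proof.
have m : measurable_fun setT (fun z : TR * TR => c * z.1 * z.2 : TR).
  apply: measurable_funM; last exact: measurable_snd.
  by apply: measurable_funM => //; exact: measurable_fst.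
split.
  apply: (measurableT_comp _ m); apply: continuous_measurable_fun; exact: continuous_cos.
apply: (measurableT_comp _ m); apply: continuous_measurable_fun; exact: continuous_sin.
Qed.

Lemma cis_kernel_mul D D' c phi M : measurable D -> measurable D' ->
  cmeasurable D' phi ->
  (forall y, D' y -> `|complex.Re (phi y)| <= M /\ `|complex.Im (phi y)| <= M) ->
  cbounded_kernel D D' (fun x y => cis (c * x * y) * phi y).
Proof.
move=> mD mD' mphi hM.
have [p1 p2] := cmeasurable_snd mD mD' mphi.
have [c1 c2] := measurable_cos_sin_prod c.
split.
- apply: (eq_measurable_fun (fun z : TR * TR => cos (c * z.1 * z.2) * complex.Re (phi z.2) -
    sin (c * z.1 * z.2) * complex.Im (phi z.2))).
    by move=> z _; rewrite cReM.
  by apply: measurable_funB; apply: measurable_funM => //; exact: measurable_funTS.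
- apply: (eq_measurable_fun (fun z : TR * TR => cos (c * z.1 * z.2) * complex.Im (phi z.2) +
    sin (c * z.1 * z.2) * complex.Re (phi z.2))).
    by move=> z _; rewrite cImM.
  by apply: measurable_funD; apply: measurable_funM => //; exact: measurable_funTS.
- exists (M + M) => x y _ /hM [h1 h2].
  have key (a b : R) : `|b| <= M -> `|cos a * b| <= M /\ `|sin a * b| <= M.
    move=> bM; rewrite !normrM; split; rewrite -[leRHS]mul1r ler_pM//.
      by rewrite ler_norml cos_geN1 cos_le1.
    by rewrite ler_norml sin_geN1 sin_le1.
  rewrite cReM cImM /=; have [a1 a2] := key (c * x * y) _ h1.
  have [b1 b2] := key (c * x * y) _ h2.
  by split; [apply: le_trans (ler_normB _ _) _|apply: le_trans (ler_normD _ _) _]; exact: lerD.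
Qed.

Lemma cis_kernel D D' c : measurable D -> measurable D' ->
  cbounded_kernel D D' (fun x y => cis (c * x * y) : R[i]).
Proof.
move=> mD mD'; have [c1 c2] := measurable_cos_sin_prod c.
split; [exact: measurable_funTS|exact: measurable_funTS|].
exists 1 => x y _ _ /=; split; first by rewrite ler_norml cos_geN1 cos_le1.
by rewrite ler_norml sin_geN1 sin_le1.
Qed.

(** The symmetry of the kernel e^{icxy} in x and y. *)
Lemma Fc_kernelE c phi x : Fc c phi x = cintegral `[-1, 1] (fun y => phi y * cis (c * y * x)).
Proof. by apply: eq_cintegral => y _; rewrite mulrC [c * x * y]mulrAC. Qed.

Lemma cmeasurable_Fc c phi : cintegrable `[-1, 1] phi -> cmeasurable `[-1, 1] (Fc c phi).
Proof.
move=> iphi.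
have mI : measurable (`[-1, 1]%classic : set TR) by exact: measurable_itv.
have [m1 m2] := cmeasurable_kernel_integral mI mI (lebesgue_itv_finite _ _ _ _) iphi
  (cis_kernel c mI mI).
split.
  by apply: (eq_measurable_fun _ _ m1) => x _; rewrite Fc_kernelE.
by apply: (eq_measurable_fun _ _ m2) => x _; rewrite Fc_kernelE.
Qed.

(** F_c is symmetric for the bilinear pairing, and psi is an eigenfunction. *)
Lemma coefL2_Fc c (psi : R -> R) (lam : R[i]) phi M :
  inL2 `[-1, 1] (fun x => (psi x)%:C) ->
  {ae mu, forall x : R, -1 <= x <= 1 -> Fc c (fun y => (psi y)%:C) x = lam * (psi x)%:C} ->
  cmeasurable `[-1, 1] phi ->
  (forall y, `|complex.Re (phi y)| <= M /\ `|complex.Im (phi y)| <= M) ->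
  coefL2 psi (Fc c phi) = lam * coefL2 psi phi.
Proof.
move=> p2 eig mphi hM.
have mI : measurable (`[-1, 1]%classic : set TR) by exact: measurable_itv.
have ip : cintegrable `[-1, 1] (fun x => (psi x)%:C).
  by apply: inL2_cintegrable p2 => //; exact: lebesgue_itv_finite.
have mp : cmeasurable `[-1, 1] (fun x => (psi x)%:C) by case: p2.
rewrite /coefL2 /Fc cintegral_fubini//;
  [|exact: lebesgue_itv_finite|exact: (@cis_kernel_mul _ _ c phi M)].
transitivity (cintegral `[-1, 1] (fun y => phi y * Fc c (fun x => (psi x)%:C) y)).
  apply: eq_cintegral => y _; rewrite Fc_kernelE -cintegralZ//; last first.
    apply: (@cintegrableM _ _ _ _ 1) ip => //.
      have [h1 h2] := measurable_cos_sin_line (c * y).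
      by split; apply: measurable_funTS; [move: h1|move: h2];
        apply: eq_measurable_fun => x _; rewrite /= mulrAC.
    move=> x _; split; first by rewrite ler_norml cos_geN1 cos_le1.
    by rewrite ler_norml sin_geN1 sin_le1.
  by apply: eq_cintegral => x _; ring.
rewrite -cintegralZ//; last by apply: (@cintegrableM _ _ _ _ M) ip.
apply: ae_eq_cintegral => //.
- by apply: cmeasurableM => //; exact: cmeasurable_Fc.
- apply: (@cmeasurableM _ _ (fun=> lam) (fun x => (psi x)%:C * phi x)); first by split.
  exact: cmeasurableM.
have aeF := ae_filter_ringOfSetsType mu.
apply: (@filterS _ _ aeF _ _ _ eig) => x h; rewrite /= in_itv /= => /h ->; ring.
Qed.

Lemma cmeasurable_eq_off0 D f g : measurable D -> cmeasurable D f ->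
  (forall x, D x -> x != 0 -> g x = f x) -> cmeasurable D g.
Proof.
move=> mD [m1 m2] fg.
have me : measurable_fun D (fun x : TR => x == 0 :> R) by exact: measurable_fun_eqr.
have key (u v : TR -> R) : measurable_fun D u -> (forall x : R, D x -> x != 0 -> v x = u x) ->
    measurable_fun D v.
  move=> mu_ uv; apply: (eq_measurable_fun (fun x : TR => if (x : R) == 0 then v (0 : R) else u x)).
    by move=> x; rewrite inE => Dx; case: eqVneq => [->//|x0]; rewrite uv.
  apply: measurable_fun_if => //.
  by apply: measurable_funS mu_ => // x [].
by split; [apply: key m1 _|apply: key m2 _] => x Dx x0; rewrite fg.
Qed.

(** By symmetry the coefficients of h_{r,nu} = F_c phi are lam_j times those of
    phi, so the series for F_c^{-1} is the expansion of phi in the basis. *)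
Lemma is_Fc_inv_profile (nu : R) n r sigma f psi lam : nu - 2^-1 = n%:R ->
  0 < r -> 0 < sigma -> is_pswf (r * sigma) psi lam -> inL2 `[0, +oo[ f ->
  {ae mu, forall s : R, sigma < s -> f s = 0} ->
  is_Fc_inv psi lam (h_ext n r (hankel nu f))
    (profile n sigma (fun s => hankel_const n sigma * f s)).
Proof.
move=> hn r0 sg0 pswf f2 supp.
have iF : cintegrable `]0, sigma] f.
  apply: inL2_cintegrable f2 => //; last exact: lebesgue_itv_finite.
  by move=> y /=; rewrite !in_itv /= andbT => /andP[/ltW].
have iCF : cintegrable `]0, sigma] (fun s => hankel_const n sigma * f s) by exact: cintegrableZ.
set phi := profile _ _ _.
have p2 : inL2 `[-1, 1] phi by exact: inL2_profile.
have lam0 j : lam j != 0.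
  rewrite -normr_gt0; have /andP[h1 h2] := pswf_decr pswf j.
  exact: lt_trans h2.
have [M hM] := profile_bounded n sg0 iCF.
have coef j : coefL2 (psi j) (h_ext n r (hankel nu f)) = lam j * coefL2 (psi j) phi.
  rewrite -(@coefL2_Fc (r * sigma) _ _ _ M)//;
    [|exact: (pswf_L2 pswf)|exact: (pswf_eigen pswf)|by case: p2].
  have iphi : cintegrable `[-1, 1] phi.
    by apply: inL2_cintegrable p2 => //; exact: lebesgue_itv_finite.
  have mF := cmeasurable_Fc (r * sigma) iphi.
  have hE x : x != 0 -> h_ext n r (hankel nu f) x = Fc (r * sigma) phi x by exact: h_ext_profile.
  have mpsi : cmeasurable `[-1, 1] (fun x => (psi j x)%:C) by case: (pswf_L2 pswf j).
  have aeF := ae_filter_ringOfSetsType mu.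
  apply: ae_eq_cintegral => //.
  - apply: cmeasurableM => //.
    by apply: (cmeasurable_eq_off0 _ mF) => // x _; exact: hE.
  - exact: cmeasurableM.
  - by apply: (@filterS _ _ aeF _ _ _ (ae_neq 0)) => x x0 _; rewrite hE.
split => //.
have := pswf_basis pswf p2; rewrite /cvgL2.
apply: cvg_trans; apply: near_eq_cvg; apply: nearW => N.
apply: eq_integral => x _; congr (sqnorm (_ - _))%:E; apply: eq_bigr => j _.
by rewrite coef mulrACA mulVf// mul1r mulrC.
Qed.

End HankelRange.

(** * The product kernel of Legendre polynomials *)

Section Kernel.
Context {R : realType}.
Notation mu := (@lebesgue_measure R).
Local Notation TR := (measurableTypeR R).
Variable n : nat.
Local Notation P := (@legendre R n).

(** The integrand has no term in 1/x, since products of coefficients of P_n of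
    total odd degree vanish; so q(x)/x, with q a polynomial, is an
    antiderivative, and its increments are those of [legendre_kernel_sum]. *)
Lemma Rintegral_legendre_kernel (s t : R) : 0 < s -> s <= t ->
  \int[mu]_(x in `[s, t]) (s * P.[x / s] / x ^+ 2 * P.[x / t]) = 1 - s / t.
Proof.
move=> s0 st; have t0 : 0 < t by exact: lt_le_trans st.
have sn0 : s != 0 by rewrite gt_eqF.
have tn0 : t != 0 by rewrite gt_eqF.
pose c k l : R := P`_k * P`_l / (k%:R + l%:R - 1) * (s^-1 ^+ k * t^-1 ^+ l).
pose q : {poly R} := \sum_(k < n.+1) \sum_(l < n.+1) c k l *: 'X^(k + l).
have qE x : q.[x] = \sum_(k < n.+1) \sum_(l < n.+1) c k l * x ^+ (k + l).
  rewrite /q horner_sum; apply: eq_bigr => k _; rewrite horner_sum; apply: eq_bigr => l _.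
  by rewrite hornerZ hornerXn.
have PE x : P.[x] = \sum_(l < n.+1) P`_l * x ^+ l.
  by rewrite [in LHS]legendre_sumE horner_sum; apply: eq_bigr => l _; rewrite hornerZ hornerXn.
have q'E x : x * q^`().[x] - q.[x] = P.[x / s] * P.[x / t].
  rewrite qE /q raddf_sum horner_sum mulr_sumr -sumrB PE mulr_suml.
  apply: eq_bigr => k _; rewrite raddf_sum horner_sum mulr_sumr -sumrB PE mulr_sumr.
  apply: eq_bigr => l _.
  rewrite /= derivZ derivXn hornerZ hornerMn hornerXn.
  have [od|ev] := boolP (odd (k + l)).
    have : odd (n + k) || odd (n + l) by move: od; lia.
    by case/orP => /legendre_parity h; rewrite /c h; ring.
  have kl1 : k%:R + l%:R - 1 != 0 :> R.
    rewrite -natrD subr_eq0 -[1]/(1%:R) eqr_nat.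
    by apply: contraNneq ev => ->.
  have e : x * (c k l * (x ^+ (k + l).-1 *+ (k + l))) = c k l * (k%:R + l%:R) * x ^+ (k + l).
    case: (k + l)%N (natrD R k l) => [|m] <-; first by rewrite !mulr0n; ring.
    by rewrite -mulr_natr exprS /=; ring.
  rewrite e -mulrA -mulrBr.
  rewrite (_ : _ - _ = (k%:R + l%:R - 1) * x ^+ (k + l)); last by ring.
  by rewrite /c !exprMn exprD; field.
have dq (x : R) : 0 < x -> is_derive x 1 (fun y : R => q.[y] / y) (P.[x / s] * P.[x / t] / x ^+ 2).
  move=> x0; have xn0 : x != 0 by rewrite gt_eqF.
  rewrite (_ : (fun y : R => q.[y] / y) = horner q * (fun y => y^-1)); last first.
    by apply/funext => y; rewrite !fctE.
  have dV : is_derive x 1 (fun y : R => y^-1) (- x ^- 2 *: 1).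
    exact: (@is_deriveV _ id x 1 1 xn0 (is_derive_id x 1)).
  apply: (trigger_derive (is_deriveM (is_derive_poly q x) dV)).
  by rewrite /GRing.scale /= -(q'E x); field.
have xpos x : x \in `[s, t]%classic -> 0 < x.
  by rewrite inE /= in_itv /= => /andP[sx _]; exact: lt_le_trans sx.
have cf (x : R) : 0 < x -> {for x, continuous (fun x : R => P.[x / s] * P.[x / t] / x ^+ 2)}.
  move=> x0; have cP (a : R) : {for x, continuous (fun x : R => P.[x / a])}.
    by apply: (@continuous_comp _ _ _ (fun x : R => x / a) (horner P));
      [exact: mulrr_continuous|exact: continuous_horner].
  apply: cvgM; first by apply: cvgM; exact: cP.
  by apply: cvgV; [rewrite expf_neq0 ?gt_eqF|exact: exprn_continuous].
have -> : \int[mu]_(x in `[s, t]) (s * P.[x / s] / x ^+ 2 * P.[x / t]) =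
    s * \int[mu]_(x in `[s, t]) (P.[x / s] * P.[x / t] / x ^+ 2).
  rewrite -RintegralZl//; last by apply: continuous_itv_integrable => x /xpos; exact: cf.
  by apply: eq_Rintegral => x _; ring.
rewrite (@Rintegral_FTC _ _ (fun y => q.[y] / y))//; last 2 first.
- by move=> x /xpos; exact: cf.
- by move=> x /xpos; exact: dq.
transitivity (s * (s^-1 - t^-1)); last by rewrite mulrBr mulfV.
congr (s * _); rewrite -(legendre_kernel_sum n sn0 tn0) !qE.
rewrite !mulr_suml -sumrB; apply: eq_bigr => k _; rewrite !mulr_suml -sumrB.
apply: eq_bigr => l _; rewrite /c !exprMn !exprD !exprVn.
set B := P`_k * _ / _.
by field; rewrite !expf_neq0// sn0 tn0.
Qed.

End Kernel.

Section Tail.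
Context {R : realType}.
Notation mu := (@lebesgue_measure R).
Local Notation TR := (measurableTypeR R).
Variables (n : nat) (sigma : R).
Hypothesis sigma0 : 0 < sigma.
Local Notation P := (@legendre R n).

(** The integral of F(t)/t from u to sigma, written over a fixed interval so that
    Fubini applies. *)
Definition tail_density (F : R -> R) (u : R) : R :=
  \int[mu]_(t in `]0, sigma]) (F t * (if u <= t then t^-1 else 0)).

Let mI : measurable (`]0, sigma]%classic : set TR). Proof. exact: measurable_itv. Qed.

Lemma measurable_le_kernel (v : TR * TR -> R) (D : set (TR * TR)) : measurable D ->
  measurable_fun D v -> measurable_fun D (fun z => if z.2 <= z.1 then v z else 0).
Proof.
move=> mD mv; apply: measurable_fun_if => //.
- apply: measurable_fun_ler; apply: measurable_funTS; [exact: measurable_snd|exact: measurable_fst].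
- by apply: measurable_funS mv => // z [].
Qed.

Lemma Rintegral_cut_kernel (v : R -> R) s t : 0 < s <= sigma -> 0 < t <= sigma ->
  \int[mu]_(u in `[s, sigma]) (if u <= t then v u else 0) =
  if s <= t then \int[mu]_(u in `[s, t]) v u else 0.
Proof.
move=> /andP[s0 ss] /andP[t0 ts].
case: ifPn => st; last first.
  rewrite /Rintegral integral0_eq// => u /=; rewrite in_itv /= => /andP[su _].
  by rewrite ifF//; apply: contraNF st; exact: le_trans.
rewrite Rintegral_mkcond [RHS]Rintegral_mkcond; apply: eq_Rintegral => u _.
rewrite !patchE; case: ifPn => [|]; rewrite (inE, notin_setE) /= in_itv /=.
  move=> /andP[su us]; case: ifPn => [ut|tu].
    by rewrite mem_set//= in_itv /= su.
  by rewrite memNset//= in_itv /= (negbTE tu) andbF.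
move=> h; rewrite memNset//= in_itv /= => /andP[su ut]; apply: h.
by rewrite su (le_trans ut).
Qed.

(** The inner integral of 1/t over u in [s, t] is 1 - s/t. *)
Lemma tail_fubini (F : R -> R) (s : R) :
  mu.-integrable `]0, sigma] (EFin \o F) -> 0 < s <= sigma ->
  \int[mu]_(u in `[s, sigma]) tail_density F u =
  \int[mu]_(t in `]0, sigma]) (F t * (if s <= t then 1 - s / t else 0)).
Proof.
move=> iF s0s; have /andP[s0 ss] := s0s.
have mJ : measurable (`[s, sigma]%classic : set TR) by exact: measurable_itv.
pose w (z : TR * TR) : R := if z.2 <= z.1 then z.1^-1 else 0.
rewrite -(@Rintegral_fubini_bounded _ `]0, sigma]%classic `[s, sigma]%classic mI mJ
  (lebesgue_itv_finite _ _ _ _) F iF w s^-1)//; first last.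
- move=> t u; rewrite /w /= !in_itv /= => /andP[t0 _] /andP[su _].
  case: ifPn => ut; last by rewrite normr0 invr_ge0 ltW.
  by rewrite normfV gtr0_norm// lef_pV2 ?posrE// (le_trans su).
- apply: measurable_le_kernel; first exact: measurableX.
  apply: (@measurable_comp _ _ _ _ _ _ `]0, sigma]%classic (fun t : TR => t^-1 : R) _ fst) => //.
  - by move=> _ [z [h _] <-].
  - exact: measurable_inv_pos.
  - by apply: measurable_funTS; exact: measurable_fst.
apply: eq_Rintegral => t; rewrite inE /= in_itv /= => t0s; congr (_ * _).
have /andP[t0 ts] := t0s.
rewrite /w /= (Rintegral_cut_kernel (fun=> t^-1) s0s t0s); case: ifPn => // st.
rewrite (@Rintegral_FTC _ _ (fun u => u * t^-1))//.
- by field; rewrite gt_eqF.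
- by move=> u _; exact: cst_continuous.
- move=> u _; rewrite (_ : (fun u : R => u / t) = t^-1 \*: id); last first.
    by apply/funext => z /=; rewrite /GRing.scale /= mulrC.
  by apply: trigger_derive; rewrite /GRing.scale /= mulr1.
Qed.

(** After Fubini the inner integral is s (1/s - 1/t) = 1 - s/t, the same as for
    [tail_fubini]. *)
Lemma legendre_tail_real (F : R -> R) (s : R) :
  mu.-integrable `]0, sigma] (EFin \o F) -> 0 < s <= sigma ->
  \int[mu]_(u in `[s, sigma]) (s * P.[u / s] / u ^+ 2 *
    \int[mu]_(t in `]0, sigma]) (F t * legendre_cut n sigma t (u / sigma))) =
  \int[mu]_(u in `[s, sigma]) tail_density F u.
Proof.
move=> iF s0s; have /andP[s0 ss] := s0s.
have sgn0 : sigma != 0 by rewrite gt_eqF.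
have mJ : measurable (`[s, sigma]%classic : set TR) by exact: measurable_itv.
rewrite tail_fubini//.
(* P(u/s) as a polynomial in u/sigma: that variable stays in [0, 1] for u in
   [s, sigma], where the sum of the absolute values of the coefficients bounds it *)
pose Q : {poly R} := P \Po (s^-1 *: 'X) \Po (sigma *: 'X).
pose v (z : TR * TR) : R := s * P.[z.2 / s] / z.2 ^+ 2 * P.[z.2 / z.1].
pose w (z : TR * TR) : R := if z.2 <= z.1 then v z else 0.
have cutE t u : 0 < u -> legendre_cut n sigma t (u / sigma) = if u <= t then P.[u / t] else 0.
  move=> u0; rewrite /legendre_cut gtr0_norm ?divr_gt0//.
  by rewrite !(mulrC sigma) divfK.
transitivity (\int[mu]_(u in `[s, sigma]) \int[mu]_(t in `]0, sigma]) (F t * w (t, u))).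
  apply: eq_Rintegral => u; rewrite inE /= in_itv /= => /andP[su us].
  have u0 : 0 < u by exact: lt_le_trans su.
  rewrite -RintegralZl//; last first.
    apply: (@integrableM_bounded _ _ _ _ (polynorm P)) iF => //.
      exact: cut_section_measurable.
    by move=> t; rewrite /= in_itv /= => /andP[t0 _]; exact: legendre_cut_le.
  apply: eq_Rintegral => t _; rewrite cutE// /w /v /=; case: ifP => _; last by rewrite !mulr0.
  by ring.
rewrite -(@Rintegral_fubini_bounded _ `]0, sigma]%classic `[s, sigma]%classic mI mJ
  (lebesgue_itv_finite _ _ _ _) F iF w (sigma * polynorm Q / s ^+ 2 * polynorm P))//;
  first last.
- move=> t u; rewrite /w /v /= !in_itv /= => /andP[t0 _] /andP[su us].
  have u0 : 0 < u by exact: lt_le_trans su.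
  have bnd0 : 0 <= sigma * polynorm Q / s ^+ 2.
    by rewrite divr_ge0 ?exprn_ge0 ?mulr_ge0 ?polynorm_ge0// ltW.
  case: ifPn => ut; last by rewrite normr0 mulr_ge0 ?polynorm_ge0.
  rewrite normrM ler_pM//; last first.
    by rewrite norm_horner_le// ger0_norm ?divr_ge0 ?(ltW u0) ?(ltW t0)// ler_pdivrMr// mul1r.
  rewrite normrM ler_pM//.
    rewrite normrM (gtr0_norm s0) ler_pM ?(ltW s0)//.
    have -> : P.[u / s] = Q.[u / sigma].
      rewrite /Q !horner_comp !hornerZ !hornerX; congr (_ * horner _ _); field.
      by rewrite sgn0 gt_eqF.
    by rewrite norm_horner_le// ger0_norm ?divr_ge0 ?(ltW u0) ?(ltW sigma0)// ler_pdivrMr// mul1r.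
  rewrite normfV normrX gtr0_norm// lef_pV2 ?posrE ?exprn_gt0//.
  by rewrite lerXn2r ?nnegrE// ltW.
- apply: measurable_le_kernel; first exact: measurableX.
  have mP : measurable_fun setT (horner P : TR -> TR).
    by apply: continuous_measurable_fun; exact: continuous_horner.
  have msnd : measurable_fun (`]0, sigma] `*` `[s, sigma]) (snd : TR * TR -> TR).
    by apply: measurable_funTS; exact: measurable_snd.
  have minv (p : TR * TR -> TR) : measurable_fun (`]0, sigma] `*` `[s, sigma]) p ->
     (forall z, (`]0, sigma] `*` `[s, sigma])%classic z -> `]0, sigma]%classic (p z)) ->
     measurable_fun (`]0, sigma] `*` `[s, sigma]) (fun z => (p z)^-1 : TR).
    move=> mp hp.
    apply: (@measurable_comp _ _ _ _ _ _ `]0, sigma]%classic (fun t : TR => t^-1 : R) _ p) => //.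
    + by move=> _ [z /hp h <-].
    + exact: measurable_inv_pos.
  have mi1 := minv fst _ _; have mi2 := minv snd msnd _.
  rewrite /v; apply: measurable_funM.
    apply: measurable_funM.
      apply: measurable_funM => //; apply: (measurableT_comp mP).
      exact: measurable_funM.
    apply: (eq_measurable_fun (fun z : TR * TR => (z.2^-1) ^+ 2)).
      by move=> z _; rewrite exprVn.
    apply: measurable_funX; apply: mi2 => z [_ /=]; rewrite !in_itv /= => /andP[su ->].
    by rewrite (lt_le_trans s0).
  apply: (measurableT_comp mP); apply: measurable_funM => //.
  by apply: mi1 => [|z []//]; apply: measurable_funTS; exact: measurable_fst.
apply: eq_Rintegral => t; rewrite inE /= in_itv /= => t0s; congr (_ * _).
have /andP[t0 ts] := t0s.
rewrite /w /v /= (Rintegral_cut_kernel (fun u => s * P.[u / s] / u ^+ 2 * P.[u / t]) s0s t0s).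
by case: ifPn => // st; rewrite Rintegral_legendre_kernel.
Qed.

End Tail.

(** * Almost everywhere second derivatives *)

Section TailDerivative.
Context {R : realType}.
Notation mu := (@lebesgue_measure R).
Local Notation TR := (measurableTypeR R).

Lemma twice_derivable_eq_near (g h : R -> R) (x : R) :
  (\forall y \near x, g y = h y) -> twice_derivable g x ->
  twice_derivable h x /\ derive1n 2 h x = derive1n 2 g x.
Proof.
move=> gh [d1 d2].
have gh' : \forall y \near x, derive1 g y = derive1 h y.
  apply: filterS (near_join gh) => y ghy.
  by rewrite !derive1E; exact: near_eq_derive.
split; first split.
- apply: filterS2 d1 (near_join gh) => y dy ghy.
  exact: near_eq_derivable dy.
- exact: near_eq_derivable d2.
- by rewrite /derive1n /= !derive1E; apply/esym; exact: near_eq_derive.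
Qed.

Variables (sigma : R) (F : R -> R).
Hypothesis sigma0 : 0 < sigma.
Hypothesis iF : mu.-integrable `]0, sigma] (EFin \o F).

Section FixedLeftEnd.
Variable a : R.
Hypothesis a0s : 0 < a < sigma.

Let k : R -> R := (fun t => F t / t) \_ `[a, sigma].
Let I (x : R) : R := \int[mu]_(t in `[a, x]) k t.
Let D (u : R) : R := I sigma - I u.

Let ik : mu.-integrable setT (EFin \o k).
Proof.
have /andP[a0 as_] := a0s.
have mA : measurable (`[a, sigma]%classic : set TR) by exact: measurable_itv.
have sub : `[a, sigma]%classic `<=` `]0, sigma]%classic.
  by move=> x /=; rewrite !in_itv /= => /andP[ax ->]; rewrite (lt_le_trans a0).
have h : mu.-integrable `[a, sigma] (EFin \o (fun t => F t / t)).
  apply: (@integrableM_bounded _ _ _ _ a^-1) => //.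
  - by apply: (measurable_funS _ sub (@measurable_inv_pos R sigma)).
  - move=> x /=; rewrite in_itv /= => /andP[ax _].
    by rewrite normfV gtr0_norm ?(lt_le_trans a0)// lef_pV2 ?posrE// (lt_le_trans a0).
  - by apply: integrableS iF.
by have := (integrable_mkcond _ mA).1 h; rewrite restrict_EFin.
Qed.

Let iks (A : set TR) : measurable A -> mu.-integrable A (EFin \o k).
Proof. by move=> mA; apply: integrableS ik. Qed.

Let cI x : a < x -> {for x, continuous I}.
Proof.
move=> ax; have ax1 : a < x + 1 by rewrite (lt_trans ax)// ltrDl.
have := parameterized_integral_continuous (ltW ax1) (iks (measurable_itv `[a, x + 1])).
move=> /(continuous_within_itvP _ ax1)[+ _ _]; apply.
by rewrite in_itv /= ax ltrDl ltr01.
Qed.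

Let iD x : mu.-integrable `[a, x] (EFin \o D).
Proof.
have [ax|xa] := leP a x; last first.
  by rewrite set_itv_ge ?bnd_simp -?ltNge//; exact: integrable_set0.
apply: continuous_compact_integrable; first exact: segment_compact.
have := parameterized_integral_continuous ax (iks (measurable_itv `[a, x])).
move=> h y; apply: cvgB; first exact: cvg_cst.
exact: h.
Qed.

Let densityE u : a <= u <= sigma -> tail_density sigma F u = D u.
Proof.
move=> /andP[au us]; have /andP[a0 as_] := a0s.
rewrite /D /I Rintegral_itvB//; last by exact: iks.
rewrite Rintegral_itv_obnd_cbnd; last by exact: iks.
rewrite /tail_density Rintegral_mkcond [RHS]Rintegral_mkcond; apply: eq_Rintegral => t _.
rewrite /k !patchE.
have e1 : (t \in `]0, sigma]%classic) = (0 < t <= sigma).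
  by apply/idP/idP; rewrite inE /= in_itv.
have e2 : (t \in `[u, sigma]%classic) = (u <= t <= sigma).
  by apply/idP/idP; rewrite inE /= in_itv.
have e3 : (t \in `[a, sigma]%classic) = (a <= t <= sigma).
  by apply/idP/idP; rewrite inE /= in_itv.
rewrite e1 e2 e3; have [ut|tu] := leP u t; last by rewrite mulr0 /=; case: ifP.
rewrite (le_trans au ut) (lt_le_trans a0 (le_trans au ut)) /=.
by case: ifP.
Qed.

Let GE s : a <= s <= sigma ->
  \int[mu]_(u in `[s, sigma]) tail_density sigma F u =
  \int[mu]_(u in `[a, sigma]) D u - \int[mu]_(u in `[a, s]) D u.
Proof.
move=> /andP[as_ ss]; rewrite Rintegral_itvB//.
rewrite Rintegral_itv_obnd_cbnd; last first.
  apply: integrableS (iD sigma) => // x /=; rewrite !in_itv /= => /andP[sx ->].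
  by rewrite (le_trans as_)// ltW.
apply: eq_Rintegral => u; rewrite inE /= in_itv /= => /andP[su us].
by rewrite densityE// us (le_trans as_).
Qed.

(** F(t)/t need not be integrable near 0, so the fundamental theorem of calculus
    is applied on [a, sigma].  There the density is I(sigma) - I(u), where I is
    the primitive of F(t)/t from a: it is continuous, hence the first derivative
    exists everywhere, and I is differentiable at Lebesgue points. *)
Lemma ae_tail_derivable_gt : {ae mu, forall s, a < s < sigma ->
  twice_derivable (fun s => \int[mu]_(u in `[s, sigma]) tail_density sigma F u) s /\
  derive1n 2 (fun s => \int[mu]_(u in `[s, sigma]) tail_density sigma F u) s = F s / s}.
Proof.
have mA : measurable (`[a, sigma]%classic : set TR) by exact: measurable_itv.
have lk : locally_integrable setT k.
  by apply: open_integrable_locally => //; exact: openT.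
have := @FTC1 R k (BLeft a) (fun y => iks (measurable_itv _)) lk.
have aeF := ae_filter_ringOfSetsType mu.
apply: (@filterS _ _ aeF) => s hs /andP[as_ ss].
pose H (s : R) := \int[mu]_(u in `[a, sigma]) D u - \int[mu]_(u in `[a, s]) D u.
have near_s : \forall y \near s, a < y < sigma.
  have : s \in `]a, sigma[ by rewrite in_itv /= as_ ss.
  by move=> /near_in_itvoo; apply: filterS => y; rewrite in_itv.
have dH y : a < y -> is_derive y 1 H (- D y).
  move=> ay; have y1 : y < y + 1 by rewrite ltrDl.
  have cD : {for y, continuous D} by apply: cvgB; [exact: cvg_cst|exact: cI].
  have [d1 d2] := @continuous_FTC1_closed R D a y (y + 1) y1 (iD _) ay cD.
  have dG : is_derive y 1 (fun y => \int[mu]_(u in `[a, y]) D u) (D y).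
    by apply: DeriveDef; [exact: d1|rewrite -derive1E; exact: d2].
  by rewrite -[- D y]add0r; exact: is_deriveB.
have sub : \forall y \near s, H y = \int[mu]_(u in `[y, sigma]) tail_density sigma F u.
  by apply: filterS near_s => y /andP[ay ys]; rewrite GE// ?ltW// !ltW.
have [dI dIE] : derivable I s 1 /\ I^`()%classic s = k s by apply: hs.
have dHE : \forall y \near s, derive1 H y = I y - I sigma.
  apply: filterS near_s => y /andP[ay _].
  by rewrite derive1E; have [_ ->] := dH y ay; rewrite /D opprB.
have dI2 : is_derive s 1 (fun y => I y - I sigma) (k s).
  have dI0 : is_derive s 1 I (k s).
    by apply: DeriveDef; [exact: dI|rewrite -derive1E; exact: dIE].
  by rewrite -[k s]subr0; exact: is_deriveB.
have tH : twice_derivable H s.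
  split.
    by apply: filterS near_s => y /andP[ay _]; have [] := dH y ay.
  apply: (near_eq_derivable (f := fun y => I y - I sigma)); last by case: dI2.
  by apply: filterS dHE => y ->.
have [t1 t2] := twice_derivable_eq_near sub tH.
split; first exact: t1.
rewrite t2 -[derive1n 2 H s]/(derive1 (derive1 H) s) derive1E (near_eq_derive _ dHE).
rewrite (@derive_val _ _ _ _ _ _ _ dI2).
have sI : `[a, sigma]%classic s by rewrite /= in_itv /= !ltW.
by rewrite /k patchE (mem_set sI).
Qed.

End FixedLeftEnd.

(** The left ends sigma/(m+2) exhaust ]0, sigma[, and countably many null sets
    have a null union. *)
Lemma ae_tail_derivable : {ae mu, forall s, 0 < s < sigma ->
  twice_derivable (fun s => \int[mu]_(u in `[s, sigma]) tail_density sigma F u) s /\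
  derive1n 2 (fun s => \int[mu]_(u in `[s, sigma]) tail_density sigma F u) s = F s / s}.
Proof.
have ha m : 0 < sigma / m.+2%:R < sigma.
  rewrite divr_gt0//= ltr_pdivrMr// ltr_pMr// ltr1n//.
have := ae_foralln (fun m => ae_tail_derivable_gt (ha m)).
have aeF := ae_filter_ringOfSetsType mu.
apply: (@filterS _ _ aeF) => s hs /andP[s0 ss].
pose m := Num.bound (sigma / s).
have hm : sigma / m.+2%:R < s.
  rewrite ltr_pdivrMr// mulrC -ltr_pdivrMr//.
  apply: lt_trans (archi_boundP _) _; first by rewrite divr_ge0 ?ltW.
  by rewrite ltr_nat.
by apply: (hs m); rewrite hm.
Qed.

End TailDerivative.

(** * Reconstruction *)

Section Reconstruction.
Context {R : realType}.
Notation mu := (@lebesgue_measure R).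
Local Notation TR := (measurableTypeR R).
Implicit Types (f phi : R -> R[i]).

Lemma cmeasurable_sum D (g : nat -> R -> R[i]) N : (forall j, cmeasurable D (g j)) ->
  cmeasurable D (fun x => \sum_(j < N) g j x).
Proof.
move=> mg; elim: N => [|N [m1 m2]].
  rewrite (_ : (fun x => _) = fun=> 0); first by split; exact: measurable_cst.
  by apply/funext => x; rewrite big_ord0.
have [g1 g2] := mg N.
rewrite (_ : (fun x => _) = fun x => \sum_(j < N) g j x + g N x); last first.
  by apply/funext => x; rewrite big_ord_recr.
split.
  by under eq_fun do rewrite raddfD /=; exact: measurable_funD.
by under eq_fun do rewrite raddfD /=; exact: measurable_funD.
Qed.

(** Equality almost everywhere on [-1, 1] is transported to [s, sigma] by the
    dilation t -> t / sigma; the rest is [legendre_tail_real] on real and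
    imaginary parts. *)
Lemma legendre_tail_profile n sigma (F : R -> R[i]) phi s :
  0 < sigma -> cintegrable `]0, sigma] F -> cmeasurable `[-1, 1] phi ->
  {ae mu, forall x, `[-1, 1]%classic x -> phi x = profile n sigma F x} ->
  0 < s <= sigma ->
  legendre_tail n sigma phi s =
  (\int[mu]_(u in `[s, sigma]) tail_density sigma (fun t => complex.Re (F t)) u) +i*
  (\int[mu]_(u in `[s, sigma]) tail_density sigma (fun t => complex.Im (F t)) u).
Proof.
move=> sg0 iF mphi phiE s0s; have /andP[s0 ss] := s0s.
have mJ : measurable (`[s, sigma]%classic : set TR) by exact: measurable_itv.
have mI : measurable (`[-1, 1]%classic : set TR) by exact: measurable_itv.
pose a (t : R) := s * (legendre n).[t / s] / t ^+ 2.
have ma : measurable_fun (`[s, sigma] : set TR) (a : TR -> R).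
  have : mu.-integrable `[s, sigma] (EFin \o a).
    apply: continuous_itv_integrable => t; rewrite inE /= in_itv /= => /andP[st _].
    apply: cvgM; last first.
      apply: cvgV; first by rewrite expf_neq0 ?gt_eqF ?(lt_le_trans s0).
      exact: exprn_continuous.
    apply: cvgM; first exact: cvg_cst.
    by apply: (@continuous_comp _ _ _ (fun x : R => x / s) (horner (legendre n)));
      [exact: mulrr_continuous|exact: continuous_horner].
  by case/integrableP => /measurable_EFinP.
have dil (g : R -> R[i]) : cmeasurable `[-1, 1] g ->
    cmeasurable `[s, sigma] (fun t => g (t / sigma)).
  have sub : (fun t : TR => t / sigma : TR) @` `[s, sigma] `<=` `[-1, 1]%classic.
    move=> y [t /= h <-]; move: h; rewrite !in_itv /= => /andP[st ts].
    rewrite ler_pdivrMr// mul1r ts andbT (le_trans (lerN10 _))// divr_ge0 ?(ltW sg0)//.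
    by rewrite (le_trans (ltW s0)).
  have md : measurable_fun (`[s, sigma] : set TR) (fun t : TR => t / sigma : TR).
    by apply: measurable_funTS; exact: measurable_dilation.
  move=> [g1 g2]; split.
    by have h := measurable_comp mI sub g1 md; exact h.
  by have h := measurable_comp mI sub g2 md; exact h.
have mprof : cmeasurable `[-1, 1] (profile n sigma F).
  by apply: measurable_profile => //; exact: lebesgue_itv_finite.
rewrite /legendre_tail (_ : cintegral _ _ =
  cintegral `[s, sigma] (fun t => (a t)%:C * profile n sigma F (t / sigma))); last first.
  apply: ae_eq_cintegral => //.
  - by apply: cmeasurableM; [exact: cmeasurable_real|exact: dil].
  - by apply: cmeasurableM; [exact: cmeasurable_real|exact: dil].
  - apply: negligibleS (negligible_dilation sg0 phiE) => t /= h1 h2; apply: h1.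
    rewrite in_itv /= => /andP[st ts]; rewrite h2// in_itv /= ler_pdivrMr// mul1r ts andbT.
    rewrite (le_trans (lerN10 _))// divr_ge0 ?(ltW sg0)//.
    by rewrite (le_trans (ltW s0)).
have [i1 i2] := iF.
rewrite -!(@legendre_tail_real R n)//.
by congr (_ +i* _); apply: eq_Rintegral => t _; rewrite profile_components (cReCM, cImCM).
Qed.

(** The endpoint s = sigma is discarded as a null set: at the other points the
    formula for the tail holds in a neighbourhood, so it can be
    differentiated. *)
Lemma reconstruction (nu : R) n r sigma psi lam f phi : nu - 2^-1 = n%:R ->
  0 < r -> 0 < sigma -> is_pswf (r * sigma) psi lam -> inL2 `[0, +oo[ f ->
  {ae mu, forall s : R, sigma < s -> f s = 0} ->
  is_Fc_inv psi lam (h_ext n r (hankel nu f)) phi ->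
  {ae mu, forall s : R, 0 < s <= sigma ->
        ctwice_derivable (legendre_tail n sigma phi) s /\
        f s = (Num.sqrt (2 * pi))%:C * 'i%C ^+ n / sigma%:C * s%:C *
              cderive2 (legendre_tail n sigma phi) s}.
Proof.
move=> hn r0 sg0 pswf f2 supp phi_inv.
have iF : cintegrable `]0, sigma] f.
  apply: inL2_cintegrable f2 => //; last exact: lebesgue_itv_finite.
  by move=> y /=; rewrite !in_itv /= andbT => /andP[/ltW].
pose F s := hankel_const n sigma * f s.
have iCF : cintegrable `]0, sigma] F by exact: cintegrableZ.
have prof_inv := is_Fc_inv_profile hn r0 sg0 pswf f2 supp.
have [[mphi _] cphi] := phi_inv; have [[mprof _] cprof] := prof_inv.
have phiE : {ae mu, forall x, `[-1, 1]%classic x -> phi x = profile n sigma F x}.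
  apply: cvgL2_unique cphi cprof => //.
  move=> N; apply: (@cmeasurable_sum _ (fun j x => (lam j)^-1 * (psi j x)%:C *
      coefL2 (psi j) (h_ext n r (hankel nu f)))) => j.
  apply: cmeasurableM; last by split; exact: measurable_cst.
  apply: cmeasurableM; first by split; exact: measurable_cst.
  by case: (pswf_L2 pswf j).
have tailE s : 0 < s <= sigma -> legendre_tail n sigma phi s =
  (\int[mu]_(u in `[s, sigma]) tail_density sigma (fun t => complex.Re (F t)) u) +i*
  (\int[mu]_(u in `[s, sigma]) tail_density sigma (fun t => complex.Im (F t)) u).
  exact: legendre_tail_profile.
have [i1 i2] := iCF.
have d1 := ae_tail_derivable sg0 i1.
have d2 := ae_tail_derivable sg0 i2.
have aeF := ae_filter_ringOfSetsType mu.
apply: (@filterS _ _ aeF _ _ _ (@filterI _ _ aeF _ _ (@filterI _ _ aeF _ _ d1 d2)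
  (ae_neq sigma))).
move=> s [[{}d1 {}d2] sne] s0s; have /andP[s0 ss] := s0s.
have s0s' : 0 < s < sigma by rewrite s0 lt_neqAle sne.
have near_s : \forall y \near s, 0 < y < sigma.
  have : s \in `]0, sigma[ by rewrite in_itv.
  by move=> /near_in_itvoo; apply: filterS => y; rewrite in_itv.
have [dr er] := d1 s0s'; have [di ei] := d2 s0s'.
have [tr1 tr2] : twice_derivable (fun y => complex.Re (legendre_tail n sigma phi y)) s /\
   derive1n 2 (fun y => complex.Re (legendre_tail n sigma phi y)) s = complex.Re (F s) / s.
  rewrite -er; apply: twice_derivable_eq_near dr.
  by apply: filterS near_s => y /andP[y0 ys]; rewrite tailE// y0 ltW.
have [ti1 ti2] : twice_derivable (fun y => complex.Im (legendre_tail n sigma phi y)) s /\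
   derive1n 2 (fun y => complex.Im (legendre_tail n sigma phi y)) s = complex.Im (F s) / s.
  rewrite -ei; apply: twice_derivable_eq_near di.
  by apply: filterS near_s => y /andP[y0 ys]; rewrite tailE// y0 ltW.
split => //.
have -> : cderive2 (legendre_tail n sigma phi) s = F s * (s^-1)%:C.
  by apply: complex_eq; rewrite /cderive2 /= ?tr2 ?ti2 (cReMC, cImMC).
have sp : Num.sqrt (2 * pi) != 0 :> R by rewrite gt_eqF// sqrtr_gt0 mulr_gt0// pi_gt0.
have c0 (x : R) : x != 0 -> x%:C != 0 :> R[i] by move=> x0; rewrite fmorph_eq0.
have i1' : (- 'i%C) ^+ n * 'i%C ^+ n = 1 :> R[i].
  by rewrite -exprMn mulNr -expr2 sqr_i opprK expr1n.
rewrite /F /hankel_const -[LHS]mul1r -[X in X * _ = _]i1' !rmorphM /= !fmorphV /=.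
by field; rewrite !c0// gt_eqF.
Qed.

Lemma h_ext_eq n r (h1 h2 : R -> R[i]) : 0 < r ->
  (forall t : R, 0 <= t <= r -> h1 t = h2 t) ->
  forall x, -1 <= x <= 1 -> h_ext n r h1 x = h_ext n r h2 x.
Proof.
move=> r0 h12 x /andP[xm1 x1]; rewrite /h_ext.
have nr : \forall y \near 0^'+, h1 (r * y) = h2 (r * y).
  near=> y; rewrite h12// mulr_ge0 ?(ltW r0)//= -[leRHS]mulr1 ler_wpM2l ?(ltW r0)//.
  by near: y; exact: nbhs_right_le.
case: eqVneq => [_|x0].
  by congr (_ +i* _); congr (lim _); rewrite eqEsubset; split;
    apply: near_eq_cvg; apply: filterS nr => y ->.
case: ifPn => xp.
  by rewrite h12// mulr_ge0 ?(ltW r0) ?(ltW xp)//= -[leRHS]mulr1 ler_wpM2l ?(ltW r0).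
have xn : x < 0 by rewrite lt_neqAle x0 leNgt.
rewrite h12// -mulrN mulr_ge0 ?(ltW r0) ?oppr_ge0 ?(ltW xn)//=.
by rewrite -[leRHS]mulr1 ler_wpM2l ?(ltW r0)// lerNl.
Unshelve. all: by end_near. Qed.

Lemma is_Fc_inv_congr psi lam (g1 g2 phi : R -> R[i]) :
  (forall x, -1 <= x <= 1 -> g1 x = g2 x) ->
  is_Fc_inv psi lam g1 phi -> is_Fc_inv psi lam g2 phi.
Proof.
move=> g12 [phi2 cphi]; split; first exact: phi2.
have coefE j : coefL2 (psi j) g1 = coefL2 (psi j) g2.
  by apply: eq_cintegral => x; rewrite /= in_itv /= => /g12 ->.
have E : (fun N y => \sum_(j < N) (lam j)^-1 * (psi j y)%:C * coefL2 (psi j) g1) =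
         (fun N y => \sum_(j < N) (lam j)^-1 * (psi j y)%:C * coefL2 (psi j) g2).
  by apply/funext => N; apply/funext => y; apply: eq_bigr => j _; rewrite coefE.
by rewrite -E.
Qed.

End Reconstruction.

Theorem theorem1p2 (R : realType) (nu : R) (n : nat) (hn : nu - 2^-1 = n%:R)
    (r sigma : R) (hr : 0 < r) (hsigma : 0 < sigma)
    (psi : nat -> R -> R) (lam : nat -> R[i])
    (hpswf : is_pswf (r * sigma) psi lam)
    (f : R -> R[i]) (hf : inL2 `[0, +oo[ f)
    (hsupp : {ae lebesgue_measure, forall s : R, sigma < s -> f s = 0}) :
  let h := hankel nu f in
  (* h_{r,nu} is in the range of F_c, and its preimage is given by the series *)
  (exists phi : R -> R[i], is_Fc_inv psi lam (h_ext n r h) phi /\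
     {ae lebesgue_measure, forall x : R, -1 <= x <= 1 ->
        Fc (r * sigma) phi x = h_ext n r h x}) /\
  (* the reconstruction formula *)
  (forall phi : R -> R[i], is_Fc_inv psi lam (h_ext n r h) phi ->
     {ae lebesgue_measure, forall s : R, 0 < s <= sigma ->
        ctwice_derivable (legendre_tail n sigma phi) s /\
        f s = (Num.sqrt (2 * pi))%:C * 'i%C ^+ n / sigma%:C * s%:C *
              cderive2 (legendre_tail n sigma phi) s}) /\
  (* h restricted to [0, r] determines f *)
  (forall f1 : R -> R[i], inL2 `[0, +oo[ f1 ->
     {ae lebesgue_measure, forall s : R, sigma < s -> f1 s = 0} ->
     (forall t : R, 0 <= t <= r -> hankel nu f1 t = h t) ->
     {ae lebesgue_measure, forall s : R, 0 <= s -> f1 s = f s}).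
Proof.
have aeF := ae_filter_ringOfSetsType (@lebesgue_measure R).
move=> h; split; [|split].
- exists (profile n sigma (fun s => hankel_const n sigma * f s)); split.
    exact: is_Fc_inv_profile hsupp.
  apply: (@filterS _ _ aeF _ _ _ (ae_neq 0)) => x x0 _.
  by rewrite -(h_ext_profile hn).
- by move=> phi; exact: reconstruction hsupp.
- move=> f1 f12 supp1 hh.
  have inv1 := is_Fc_inv_profile hn hr hsigma hpswf f12 supp1.
  set phi := profile _ _ _ in inv1.
  have inv : is_Fc_inv psi lam (h_ext n r h) phi.
    by apply: is_Fc_inv_congr inv1 => x; exact: h_ext_eq.
  have e1 := reconstruction hn hr hsigma hpswf f12 supp1 inv1.
  have e := reconstruction hn hr hsigma hpswf hf hsupp inv.
  apply: (@filterS _ _ aeF _ _ _ (@filterI _ _ aeF _ _ (@filterI _ _ aeF _ _ e1 e)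
    (@filterI _ _ aeF _ _ (@filterI _ _ aeF _ _ hsupp supp1) (ae_neq 0)))).
  move=> s [[{}e1 {}e] [[s1 s2] s0]] sge0.
  have [ss|ss] := leP s sigma; last by rewrite s1// s2.
  have s0s : 0 < s <= sigma by rewrite lt_def s0 sge0.
  by have [_ ->] := e1 s0s; have [_ ->] := e s0s.
Qed.
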